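(* Consider the two-step symmetric methods M1, M2, M3, M4 (defined in the context), with step size $h$, applied to the relativistic charged-particle system $$\frac{dx}{d\tau}=v,\qquad \frac{dt}{d\tau}=w,\qquad \frac{dv}{d\tau}=v\times B(x)-i\,w\,E(x),\qquad \frac{dw}{d\tau}=i\,E(x)\cdot v.$$ Let $\mathcal{H}(v,w)=\frac12(w^2+v^{\intercal}v)$ denote the mass shell. Assume that the numerical solution belongs to a compact set independent of $h$. Then: (i) M1 exactly preserves the mass shell, i.e. $\mathcal{H}(v_{n+1},w_{n+1})=\mathcal{H}(v_n,w_n)$. (ii) M2, M3 and M4 nearly preserve the mass shell: $$|\mathcal{H}(v_n,w_n)-\mathcal{H}(v_0,w_0)|\le Ch^2\qquad\text{for } nh\le h^{-N+2}.$$ Here $N\ge3$ is an (arbitrary fixed integer) truncation number, and $C$ is a constant independent of $n$ and $h$, but depending on $N$.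
   Context: **System.** $A:\mathbb{R}^3\to\mathbb{R}^3$ and $U:\mathbb{R}^3\to\mathbb{R}$ are smooth, $B=\nabla\times A$, $E=-\nabla U$. The unknowns are $x(\tau),v(\tau)\in\mathbb{R}^3$ and purely imaginary scalars $t(\tau),w(\tau)\in i\mathbb{R}$ (with $t=i\bar t$, $w=i\gamma$, where $\bar t$ is time and $\gamma$ the relativistic factor, $\tau$ the proper time). In $\mathcal{H}$, $w^2$ is the ordinary square of the complex number $w$ (no conjugation). **Matrices.** For $b\in\mathbb{R}^3$ let $\tilde b$ be the skew-symmetric $3\times3$ matrix with $\tilde b\,\alpha=\alpha\times b$ for all $\alpha\in\mathbb{R}^3$; thus $\tilde B(x)$, $\tilde E(x)$ are the matrices associated with $B(x)$, $E(x)$. Let $${\bm F}(x)=\begin{pmatrix}\tilde B(x)&-iE(x)\\ iE(x)^{\intercal}&0\end{pmatrix}\in\mathbb{C}^{4\times4}.$$ **Coefficients.** Let $r_1=E^{\intercal}E-B^{\intercal}B$, $r_2=-E^{\intercal}B$, $d=\sqrt{r_1^2+4r_2^2}$, $\lambda_1=(r_1+d)/2$, $\lambda_2=(r_1-d)/2$ (all functions of $x$), and, with $k=h/2$, $$K_1=\frac{\sqrt{\lambda_1}\tanh(k\sqrt{\lambda_1})-\sqrt{\lambda_2}\tanh(k\sqrt{\lambda_2})}{d},\qquad K_2=\frac{r_2}{d}\Big(\frac{\tanh(k\sqrt{\lambda_1})}{\sqrt{\lambda_1}}-\frac{\tanh(k\sqrt{\lambda_2})}{\sqrt{\lambda_2}}\Big),$$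 $$K_3=\tfrac12\Big(1-\frac{r_1}{d}\Big)\operatorname{sech}(k\sqrt{\lambda_1})+\tfrac12\Big(1+\frac{r_1}{d}\Big)\operatorname{sech}(k\sqrt{\lambda_2}),\qquad K_4=\frac{\operatorname{sech}(k\sqrt{\lambda_1})-\operatorname{sech}(k\sqrt{\lambda_2})}{d},$$ removable singularities being filled in by continuity (i.e. by the corresponding power series in $h$). These are such that $\tanh(\frac h2{\bm F})=K_1{\bm F}+K_2\hat{\bm F}$ with $\hat{\bm F}=\begin{pmatrix}\tilde E&iB\\-iB^{\intercal}&0\end{pmatrix}$, and $\operatorname{sech}(\frac h2{\bm F})=K_3{\bm I}+K_4{\bm F}^2$. Write $K_j(x)$ for the value at $x$, $S_j=K_j(x_0)$ for $j=1,\dots,4$, and $B_0=B(x_0)$. **Abbreviations.** $\delta^2x_n=\frac{x_{n+1}-2x_n+x_{n-1}}{h^2}$, $\delta x_n=\frac{x_{n+1}-x_{n-1}}{2h}$, and similarly $\delta^2t_n$, $\delta t_n$. All methods start from initial values $(x_0;t_0)$, $(v_0;w_0)$ and the starting value $(x_1;t_1)=(x_0;t_0)+h\,e^{\frac h2{\bm F}(x_0)}(v_0;w_0)$; the two-step recursions below are used for $n\ge1$. **M1.** $$\delta^2x_n=\tfrac2h\big(K_1(x_n)\tilde B(x_n)+K_2(x_n)\tilde E(x_n)\big)\delta x_n-\tfrac{2}{h}i\big(K_1(x_n)E(x_n)-K_2(x_n)B(x_n)\big)\delta t_n,$$ $$\delta^2t_n=\tfrac{2}{h}i\big(K_1(x_n)E(x_n)^{\intercal}-K_2(x_n)B(x_n)^{\intercal}\big)\delta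 x_n,$$ with momentum $(v_{n+1};w_{n+1})=e^{\frac h2{\bm F}(x_{n+1})}e^{\frac h2{\bm F}(x_n)}(v_n;w_n)$ for $n\ge0$. **M2.** $$\delta^2x_n=\tfrac2h\big(S_1\tilde B(x_n)+S_2\tilde E(x_n)\big)\delta x_n-\tfrac{2i}{h}\big(S_1E(x_n)-S_2B_0\big)\delta t_n,\qquad \delta^2t_n=\tfrac{2i}{h}\big(S_1E(x_n)^{\intercal}-S_2B_0^{\intercal}\big)\delta x_n,$$ with momentum, for $n\ge1$, $$v_n=\big(S_3I+S_4(\tilde B(x_n)^2+E(x_n)E(x_n)^{\intercal})\big)\delta x_n-iS_4\tilde B(x_n)E(x_n)\,\delta t_n,$$ $$w_n=iS_4E(x_n)^{\intercal}\tilde B(x_n)\,\delta x_n+\big(S_3+S_4E(x_n)^{\intercal}E(x_n)\big)\delta t_n.$$ **M3.** $\delta^2x_n=\tfrac2hS_1\big(\tilde B(x_n)\delta x_n-iE(x_n)\delta t_n\big)$, $\ \delta^2t_n=\tfrac{2i}{h}S_1E(x_n)^{\intercal}\delta x_n$, with momentum $v_n=S_3\,\delta x_n$, $w_n=S_3\,\delta t_n$ for $n\ge1$. **M4.** $\delta^2x_n=\tilde B(x_n)\delta x_n-iE(x_n)\delta t_n$, $\ \delta^2t_n=iE(x_n)^{\intercal}\delta x_n$, with momentum $v_n=\delta x_n$, $w_n=\delta t_n$ for $n\ge1$. *)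

(* Defs.v *)
(* Relativistic charged-particle dynamics in R^3 x iR over an arbitrary
   [R : realType]; complex numbers are [R[i]]. *)
From HB Require Import structures.
From mathcomp Require Import all_boot all_order all_algebra.
From mathcomp Require Import complex.
From mathcomp Require Import all_classical all_reals all_analysis.
Set Implicit Arguments.
Unset Strict Implicit.
Unset Printing Implicit Defensive.
Import Order.TTheory GRing.Theory Num.Theory numFieldNormedType.Exports.

Local Open Scope classical_set_scope.
Local Open Scope complex_scope.
Local Open Scope ring_scope.

Section VectorCalculus.
Variable R : realType.
Implicit Types (f : 'cV[R]_3 -> R) (G : 'cV[R]_3 -> 'cV[R]_3).

Definition partial (i : 'I_3) f : 'cV[R]_3 -> R :=
  fun x => 'D_(delta_mx i 0) f x.

Definition smooth f : Prop :=
  forall s : seq 'I_3,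
    continuous (foldr partial f s) /\
    forall (i : 'I_3) (x : 'cV[R]_3),
      derivable (foldr partial f s) x (delta_mx i 0).

Definition smooth_field G : Prop := forall i : 'I_3, smooth (fun x => G x i 0).

(* In [curl] and [cross] the indices [i + 1] and [i + 2] are taken mod 3. *)
Definition curl G (x : 'cV[R]_3) : 'cV[R]_3 :=
  \col_i (partial (i + 1) (fun y => G y (i + 2) 0) x
          - partial (i + 2) (fun y => G y (i + 1) 0) x).

Definition gradient f (x : 'cV[R]_3) : 'cV[R]_3 := \col_i partial i f x.

Definition cross (a b : 'cV[R]_3) : 'cV[R]_3 :=
  \col_i (a (i + 1) 0 * b (i + 2) 0 - a (i + 2) 0 * b (i + 1) 0).

(* The matrix of [a |-> a x b] (and not of [a |-> b x a]). *)
Definition hatmx (b : 'cV[R]_3) : 'M[R]_3 :=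
  \matrix_(i, j) cross (delta_mx j 0) b i 0.

Lemma hatmxE (b a : 'cV[R]_3) : hatmx b *m a = cross a b.
Proof.
apply/matrixP => i j; rewrite !ord1 !mxE.
under eq_bigr do rewrite !mxE /= !andbT mulrBl.
rewrite sumrB; congr (_ - _).
  rewrite (bigD1 (i + 1)) //= eqxx mul1r mulrC big1 ?addr0 // => k /negbTE.
  by rewrite eq_sym => ->; rewrite !mul0r.
rewrite (bigD1 (i + 2)) //= eqxx mul1r mulrC big1 ?addr0 // => k /negbTE.
by rewrite eq_sym => ->; rewrite !mul0r.
Qed.

Definition dot (a b : 'cV[R]_3) : R := (a^T *m b) 0 0.

End VectorCalculus.

Section ComplexFunctions.
Variable R : realType.
Implicit Types z : R[i].

Definition cexp z : R[i] :=
  (expR (complex.Re z))%:C * (cos (complex.Im z) +i* sin (complex.Im z)).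
Definition csinh z : R[i] := (cexp z - cexp (- z)) / 2.
Definition ccosh z : R[i] := (cexp z + cexp (- z)) / 2.
Definition ctanh z : R[i] := csinh z / ccosh z.
Definition csech z : R[i] := (ccosh z)^-1.

Definition expmx n (M : 'M[R[i]]_n.+1) : 'M[R[i]]_n.+1 :=
  lim (series (fun k : nat => (k`!%:R)^-1 *: M ^+ k) @ \oo).

Definition toC m n (M : 'M[R]_(m, n)) : 'M[R[i]]_(m, n) :=
  map_mx (real_complex R) M.

Definition stack (x : 'cV[R]_3) (t : R[i]) : 'cV[R[i]]_4 :=
  col_mx (toC x) (t%:M : 'M[R[i]]_1).

Definition imaginary z : Prop := complex.Re z = 0.

(* [w ^+ 2] is the square of the complex number [w], without conjugation. *)
Definition mass_shell (v : 'cV[R]_3) (w : R[i]) : R[i] :=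
  2^-1 * (w ^+ 2 + (dot v v)%:C).

End ComplexFunctions.

Section Coefficients.
Variable R : realType.
Variables (A : 'cV[R]_3 -> 'cV[R]_3) (U : 'cV[R]_3 -> R).
Variable h : R.
Implicit Type x : 'cV[R]_3.

Definition Bf x : 'cV[R]_3 := curl A x.
Definition Ef x : 'cV[R]_3 := - gradient U x.

Definition BC x : 'cV[R[i]]_3 := toC (Bf x).
Definition EC x : 'cV[R[i]]_3 := toC (Ef x).
Definition Bt x : 'M[R[i]]_3 := toC (hatmx (Bf x)).
Definition Et x : 'M[R[i]]_3 := toC (hatmx (Ef x)).

Definition Fmx x : 'M[R[i]]_4 :=
  block_mx (Bt x) (- ('i%C *: EC x)) ('i%C *: (EC x)^T) (0 : 'M[R[i]]_1).

Definition r1 x : R := dot (Ef x) (Ef x) - dot (Bf x) (Bf x).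
Definition r2 x : R := - dot (Ef x) (Bf x).
Definition dd x : R := Num.sqrt (r1 x ^+ 2 + 4 * r2 x ^+ 2).
Definition lam1 x : R := (r1 x + dd x) / 2.
Definition lam2 x : R := (r1 x - dd x) / 2.

(* [lam2 <= 0 <= lam1]; the complex root of [lam2] is purely imaginary. *)
Definition sq1 x : R[i] := sqrtC (lam1 x)%:C.
Definition sq2 x : R[i] := sqrtC (lam2 x)%:C.

Definition kk : R[i] := (h / 2)%:C.

(* [tanh (k s) / s], with its limit [k] at [s = 0]. *)
Definition tanh_div (s : R[i]) : R[i] :=
  if s == 0 then kk else ctanh (kk * s) / s.

(* When [d = 0], i.e. [r1 = r2 = 0] and [lam1 = lam2 = 0], the coefficients
   are given their limits for [(r1, r2) -> (0, 0)]; these are obtained from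
   [sqrt l * tanh (k * sqrt l) = k * l + O(l ^ 2)] and
   [sech (k * sqrt l) = 1 - k ^ 2 * l / 2 + O(l ^ 2)].
   At a pole of tanh or sech, which is not a removable singularity, the
   coefficients have the arbitrary value given by [0^-1 = 0]; for bounded
   fields this does not occur when [h] is small. *)
Definition K1 x : R[i] :=
  if dd x == 0 then kk
  else (sq1 x * ctanh (kk * sq1 x) - sq2 x * ctanh (kk * sq2 x)) / (dd x)%:C.
Definition K2 x : R[i] :=
  if dd x == 0 then 0
  else (r2 x / dd x)%:C * (tanh_div (sq1 x) - tanh_div (sq2 x)).
Definition K3 x : R[i] :=
  if dd x == 0 then 1
  else 2^-1 * (1 - r1 x / dd x)%:C * csech (kk * sq1 x)
       + 2^-1 * (1 + r1 x / dd x)%:C * csech (kk * sq2 x).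
Definition K4 x : R[i] :=
  if dd x == 0 then - (kk ^+ 2 / 2)
  else (csech (kk * sq1 x) - csech (kk * sq2 x)) / (dd x)%:C.

End Coefficients.

Section Differences.
Variables (R : realType) (V : lmodType R[i]) (h : R).
Implicit Type u : nat -> V.

(* Only used for [n >= 1]. *)
Definition delta2 u (n : nat) : V :=
  ((h ^+ 2)^-1)%:C *: (u n.+1 - u n *+ 2 + u n.-1).
Definition delta1 u (n : nat) : V := ((2 * h)^-1)%:C *: (u n.+1 - u n.-1).

End Differences.

Section Methods.
Variable R : realType.
Variables (A : 'cV[R]_3 -> 'cV[R]_3) (U : 'cV[R]_3 -> R).
Variables (x0 : 'cV[R]_3) (t0 : R[i]) (v0 : 'cV[R]_3) (w0 : R[i]).
Variable h : R.
Variables (x : nat -> 'cV[R]_3) (t : nat -> R[i]).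
Variables (v : nat -> 'cV[R]_3) (w : nat -> R[i]).

Let D2x (n : nat) : 'cV[R[i]]_3 := delta2 h (fun m => toC (x m)) n.
Let D1x (n : nat) : 'cV[R[i]]_3 := delta1 h (fun m => toC (x m)) n.
Let D2t (n : nat) : R[i] := delta2 h (t : nat -> R[i]^o) n.
Let D1t (n : nat) : R[i] := delta1 h (t : nat -> R[i]^o) n.

Let B n := BC A (x n).
Let E n := EC U (x n).
Let Bn n := Bt A (x n).
Let En n := Et U (x n).

Definition expF (y : 'cV[R]_3) : 'M[R[i]]_4 := expmx ((h / 2)%:C *: Fmx A U y).

Definition starting : Prop :=
  [/\ (x 0%N, t 0%N, v 0%N, w 0%N) = (x0, t0, v0, w0),
      stack (x 1%N) (t 1%N) =
        stack x0 t0 + h%:C *: (expF x0 *m stack v0 w0)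
    & forall n, imaginary (t n) /\ imaginary (w n)].

Definition method1 : Prop :=
  [/\ starting,
      forall n, (0 < n)%N ->
        let k1 := K1 A U h (x n) in let k2 := K2 A U h (x n) in
        D2x n = (2 / h)%:C *: ((k1 *: Bn n + k2 *: En n) *m D1x n)
                - ((2 / h)%:C * 'i%C * D1t n) *: (k1 *: E n - k2 *: B n) /\
        D2t n = (2 / h)%:C * 'i%C
                * ((k1 *: (E n)^T - k2 *: (B n)^T) *m D1x n) 0 0
    & forall n, stack (v n.+1) (w n.+1) =
                expF (x n.+1) *m (expF (x n) *m stack (v n) (w n))].

Let S1 := K1 A U h x0.
Let S2 := K2 A U h x0.
Let S3 := K3 A U h x0.
Let S4 := K4 A U h x0.
Let B0 := BC A x0.

Definition method2 : Prop :=
  [/\ starting,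
      forall n, (0 < n)%N ->
        D2x n = (2 / h)%:C *: ((S1 *: Bn n + S2 *: En n) *m D1x n)
                - ((2 / h)%:C * 'i%C * D1t n) *: (S1 *: E n - S2 *: B0) /\
        D2t n = (2 / h)%:C * 'i%C
                * ((S1 *: (E n)^T - S2 *: B0^T) *m D1x n) 0 0
    & forall n, (0 < n)%N ->
        toC (v n) = (S3%:M + S4 *: (Bn n *m Bn n + E n *m (E n)^T)) *m D1x n
                    - ('i%C * S4 * D1t n) *: (Bn n *m E n) /\
        w n = 'i%C * S4 * ((E n)^T *m Bn n *m D1x n) 0 0
              + (S3 + S4 * ((E n)^T *m E n) 0 0) * D1t n].

Definition method3 : Prop :=
  [/\ starting,
      forall n, (0 < n)%N ->
        D2x n = ((2 / h)%:C * S1) *: (Bn n *m D1x n - ('i%C * D1t n) *: E n) /\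
        D2t n = (2 / h)%:C * 'i%C * S1 * ((E n)^T *m D1x n) 0 0
    & forall n, (0 < n)%N ->
        toC (v n) = S3 *: D1x n /\ w n = S3 * D1t n].

Definition method4 : Prop :=
  [/\ starting,
      forall n, (0 < n)%N ->
        D2x n = Bn n *m D1x n - ('i%C * D1t n) *: E n /\
        D2t n = 'i%C * ((E n)^T *m D1x n) 0 0
    & forall n, (0 < n)%N -> toC (v n) = D1x n /\ w n = D1t n].

(* The numerical solution stays in [K] up to step [n]; [w m] is purely
   imaginary and is represented by [gamma = Im (w m)].  The component [t m]
   is left free: the fields do not depend on it, and it grows linearly along
   physical trajectories. *)
Definition stays_in (K : set ('cV[R]_3 * 'cV[R]_3 * R)) (n : nat) : Prop :=
  forall m, (m <= n)%N -> K (x m, v m, complex.Im (w m)).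

End Methods.

(* Main.v *)
Require Import Defs.
From mathcomp Require Import all_boot all_order all_algebra.
From mathcomp Require Import complex ring lra.
From mathcomp Require Import all_classical all_reals all_analysis.
Import Order.TTheory GRing.Theory Num.Theory numFieldNormedType.Exports.

Local Open Scope classical_set_scope.
Local Open Scope complex_scope.
Local Open Scope ring_scope.

Set Implicit Arguments.
Unset Strict Implicit.
Unset Printing Implicit Defensive.

(** Write [X = (x; t)], [V = (v; w)] in complex 4-space and [q(Y) = Y^T Y] for the
    bilinear square, so that the mass shell is [q(V) / 2].  Everything rests on
    one fact: the field matrix [F] is skew-symmetric for the transpose without
    conjugation, and so are all the matrices obtained by mixing the blocks of
    such matrices.

    For the first method, the exponential of a skew matrix is orthogonal
    ([expmx_orth]), hence the momentum update preserves [q].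

    The three other methods have a common form ([skew_scheme]):
      [delta2 X = G (delta1 X)] and [V = delta1 X + P (delta1 X)],
    with [G] skew and bounded, and [P = O(h ^ 2)].  Let [D n] be the increment
    [X (n + 1) - X n].  Then [D n - D (n - 1)] and [D n + D (n - 1)] are multiples
    of [delta2 X] and [delta1 X], and [Y^T G Y = 0] by skewness, so that
    [q(D n) = q(D (n - 1))] exactly ([increment_square]): the scheme has the
    invariant [q(D n)], equal to [h ^ 2 q(V 0)] because the starting step is
    an orthogonal image of the initial momentum.  The parallelogram identity
    turns this into
      [q(delta1 X) = q(V 0) - h ^ 2 / 4 q(delta2 X)]
    ([delta1_energy]), and passing from [delta1 X] to [V] costs one more [O(h ^ 2)]
    ([cform_perturb]).  Since [q(D n)] is conserved exactly, errors do not
    accumulate from one step to the next, and the constant does not depend on [n].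

    What remains is that the bounds are uniform.  The coefficients [S1, ..., S4]
    are taken at the fixed point [x0], and satisfy [S1, S2 = O(h)] and
    [S3 - 1, S4 = O(h ^ 2)] ([Oh_K1] to [Oh_K4]); the fields are bounded on the
    compact set ([state_bound]); and a step [h] that is not small is no obstacle,
    since the mass shell itself is bounded there. *)

(** * Modulus and a submultiplicative matrix norm *)

Notation cmod := ComplexField.Normc.normc.

Section Modulus.
Variable R : realType.
Implicit Types (z : R[i]) (a : R).

Lemma normr_cmod z : `|z| = (cmod z)%:C.
Proof. by []. Qed.

Lemma cmod_ge0 z : 0 <= cmod z.
Proof. by case: z => a b; rewrite sqrtr_ge0. Qed.

Lemma cmodM z1 z2 : cmod (z1 * z2) = cmod z1 * cmod z2.
Proof. exact: ComplexField.Normc.normcM. Qed.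

Lemma cmodN z : cmod (- z) = cmod z.
Proof. exact: normcN. Qed.

Lemma cmodB_le z1 z2 : cmod (z1 - z2) <= cmod z1 + cmod z2.
Proof. by rewrite -(cmodN z2); exact: le_normcD. Qed.

Lemma cmodD_le z1 z2 : cmod (z1 + z2) <= cmod z1 + cmod z2.
Proof. exact: le_normcD. Qed.

Lemma cmodV z : cmod z^-1 = (cmod z)^-1.
Proof. exact: ComplexField.Normc.normcV. Qed.

Lemma cmod0 : cmod (0 : R[i]) = 0.
Proof. exact: ComplexField.Normc.normc0. Qed.

Lemma cmod1 : cmod (1 : R[i]) = 1.
Proof. exact: ComplexField.Normc.normc1. Qed.

Lemma cmod_real a : cmod a%:C = `|a|.
Proof. by rewrite /= expr0n addr0 sqrtr_sqr. Qed.

Lemma cmod_nat k : cmod (k%:R : R[i]) = k%:R.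
Proof. by rewrite -(rmorph_nat (real_complex R)) cmod_real ger0_norm. Qed.

Lemma cmodi : cmod ('i%C : R[i]) = 1.
Proof. by rewrite /= expr0n add0r expr1n sqrtr1. Qed.

Lemma cmod_sum (I : Type) (r : seq I) (F : I -> R[i]) :
  cmod (\sum_(i <- r) F i) <= \sum_(i <- r) cmod (F i).
Proof.
elim/big_rec2: _ => [|i y1 y2 _ le12]; first by rewrite cmod0.
by apply: le_trans (cmodD_le _ _) _; rewrite lerD2l.
Qed.

Lemma ge_Re_cmod z : `|complex.Re z| <= cmod z.
Proof. by case: z => a b /=; rewrite -sqrtr_sqr ler_wsqrtr // lerDl sqr_ge0. Qed.

Lemma ge_Im_cmod z : `|complex.Im z| <= cmod z.
Proof. by case: z => a b /=; rewrite -sqrtr_sqr ler_wsqrtr // lerDr sqr_ge0. Qed.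

Lemma cmod_le_ReIm z : cmod z <= `|complex.Re z| + `|complex.Im z|.
Proof.
rewrite {1}[z]complexE (le_trans (cmodD_le _ _)) //.
by rewrite cmodM cmodi mul1r !cmod_real.
Qed.

End Modulus.

Section MatrixNorm.
Variable R : realType.

(** The entrywise sum of moduli: it takes values in [R] rather than in [R[i]],
    and, unlike the maximum norm, it is submultiplicative. *)
Definition mnorm m n (M : 'M[R[i]]_(m, n)) : R := \sum_i \sum_j cmod (M i j).

Lemma mnorm_ge0 m n (M : 'M[R[i]]_(m, n)) : 0 <= mnorm M.
Proof. by apply: sumr_ge0 => i _; apply: sumr_ge0 => j _; exact: cmod_ge0. Qed.

Lemma cmod_le_mnorm m n (M : 'M[R[i]]_(m, n)) i j : cmod (M i j) <= mnorm M.
Proof.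
rewrite /mnorm (bigD1 i) //= (bigD1 j) //= -addrA lerDl.
by rewrite addr_ge0 //; do ?[apply: sumr_ge0 => *]; exact: cmod_ge0.
Qed.

Lemma mnorm0 m n : mnorm (0 : 'M[R[i]]_(m, n)) = 0.
Proof. by apply: big1 => i _; apply: big1 => j _; rewrite mxE cmod0. Qed.

Lemma mnormD m n (M1 M2 : 'M[R[i]]_(m, n)) : mnorm (M1 + M2) <= mnorm M1 + mnorm M2.
Proof.
rewrite /mnorm -big_split /=; apply: ler_sum => i _.
by rewrite -big_split /=; apply: ler_sum => j _; rewrite !mxE; exact: cmodD_le.
Qed.

Lemma mnormN m n (M : 'M[R[i]]_(m, n)) : mnorm (- M) = mnorm M.
Proof. by apply: eq_bigr => i _; apply: eq_bigr => j _; rewrite !mxE cmodN. Qed.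

Lemma mnormZ m n c (M : 'M[R[i]]_(m, n)) : mnorm (c *: M) = cmod c * mnorm M.
Proof.
rewrite mulr_sumr; apply: eq_bigr => i _; rewrite mulr_sumr.
by apply: eq_bigr => j _; rewrite mxE cmodM.
Qed.

Lemma mnormM m n p (M1 : 'M[R[i]]_(m, n)) (M2 : 'M[R[i]]_(n, p)) :
  mnorm (M1 *m M2) <= mnorm M1 * mnorm M2.
Proof.
rewrite /mnorm mulr_suml; apply: ler_sum => i _.
rewrite mulr_suml.
apply: (@le_trans _ _ (\sum_j \sum_k cmod (M1 i k) * cmod (M2 k j))).
  apply: ler_sum => j _; rewrite mxE; apply: le_trans (cmod_sum _ _) _.
  by apply: ler_sum => k _; rewrite cmodM.
rewrite exchange_big /=; apply: ler_sum => k _; rewrite -mulr_sumr.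
rewrite ler_wpM2l ?cmod_ge0 // (bigD1 k) //= lerDl.
by do 2![apply: sumr_ge0 => *]; exact: cmod_ge0.
Qed.

Lemma mnormT m n (M : 'M[R[i]]_(m, n)) : mnorm M^T = mnorm M.
Proof.
by rewrite /mnorm exchange_big; do 2![apply: eq_bigr => ? _]; rewrite mxE.
Qed.

Lemma mnorm1 n : mnorm (1%:M : 'M[R[i]]_n) = n%:R.
Proof.
rewrite /mnorm (eq_bigr (fun=> 1)) => [|i _]; first by rewrite sumr_const card_ord.
rewrite (bigD1 i) //= big1 => [|j]; rewrite !mxE ?eqxx ?cmod1 ?addr0 //.
by rewrite eq_sym => /negbTE ->; rewrite cmod0.
Qed.

Lemma mnorm_block m1 m2 n1 n2 (a : 'M[R[i]]_(m1, n1)) (b : 'M[R[i]]_(m1, n2))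
    (c : 'M[R[i]]_(m2, n1)) (d : 'M[R[i]]_(m2, n2)) :
  mnorm (block_mx a b c d) = mnorm a + mnorm b + mnorm c + mnorm d.
Proof.
rewrite /mnorm big_split_ord /= -addrA; congr (_ + _); rewrite -big_split /=;
  by apply: eq_bigr => i _; rewrite big_split_ord /=; congr (_ + _);
  apply: eq_bigr => j _; rewrite ?block_mxEul ?block_mxEur ?block_mxEdl ?block_mxEdr.
Qed.

Lemma mnorm_col_mx m1 m2 n (a : 'M[R[i]]_(m1, n)) (b : 'M[R[i]]_(m2, n)) :
  mnorm (col_mx a b) = mnorm a + mnorm b.
Proof.
by rewrite /mnorm big_split_ord /=; congr (_ + _);
  do 2![apply: eq_bigr => ? _]; rewrite ?col_mxEu ?col_mxEd.
Qed.

(** The factor [n.+1] is the norm of the identity, needed for [k = 0]. *)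
Lemma mnormX n (M : 'M[R[i]]_n.+1) k : mnorm (M ^+ k) <= n.+1%:R * mnorm M ^+ k.
Proof.
elim: k => [|k IHk]; first by rewrite !expr0 mulr1 mnorm1.
rewrite !exprSr mulrA; apply: (le_trans (mnormM (M ^+ k) M)).
by rewrite ler_wpM2r // mnorm_ge0.
Qed.

Lemma mnorm_le m n (M : 'M[R[i]]_(m, n)) b :
  (forall i j, cmod (M i j) <= b) -> mnorm M <= b *+ (m * n).
Proof.
move=> le_b; apply: (@le_trans _ _ (\sum_(i < m) \sum_(j < n) b)).
  by do 2![apply: ler_sum => ? _].
by rewrite !sumr_const !card_ord -mulrnA mulnC.
Qed.

End MatrixNorm.

(** * Entrywise convergence *)

Section Limits.
Variable R : realType.

Lemma cvg_complex (u : nat -> R[i]) (l : R[i]) :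
  (fun n => complex.Re (u n)) @ \oo --> complex.Re l ->
  (fun n => complex.Im (u n)) @ \oo --> complex.Im l ->
  (u : nat -> R[i]^o) @ \oo --> (l : R[i]^o).
Proof.
move=> /cvgrPdist_lt cRe /cvgrPdist_lt cIm; apply/cvgrPdist_lt => -[e e'].
rewrite ltcE /= => /andP[/eqP-> e_gt0].
have e2 : 0 < e / 2 by rewrite divr_gt0.
near=> n; rewrite normr_cmod ltcR; apply: le_lt_trans (cmod_le_ReIm _) _.
rewrite [ltRHS](splitr e) !raddfB /=; apply: ltrD; near: n; [exact: cRe|exact: cIm].
Unshelve. all: by end_near. Qed.

Lemma cvg_mx (K : numFieldType) m n (u : nat -> 'M[K]_(m.+1, n.+1))
    (l : 'M[K]_(m.+1, n.+1)) :
  (forall i j, (fun k => u k i j) @ \oo --> l i j) -> u @ \oo --> l.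
Proof.
move=> ul; apply/cvg_ballP => e e_gt0.
suff : \forall k \near \oo, forall ij : 'I_m.+1 * 'I_n.+1,
    ball (l ij.1 ij.2) e (u k ij.1 ij.2).
  by apply: filterS => k H; split => // i j; exact: (H (i, j)).
apply: filter_forall => -[i j] /=.
by have /cvg_ballP := ul i j; apply.
Qed.

Lemma expmx_lim n (M E : 'M[R[i]]_n.+1) :
  (forall i j,
    ((fun k => (\sum_(0 <= l < k) (l`!%:R)^-1 *: M ^+ l) i j) : nat -> R[i]^o)
      @ \oo --> (E i j : R[i]^o)) ->
  expmx M = E.
Proof.
move=> cE; rewrite /expmx.
apply: (@cvg_lim ('M[R[i] : numFieldType]_n.+1 : normedModType R[i])).
  exact: norm_hausdorff.
exact: (@cvg_mx R[i]).
Qed.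

End Limits.

(** * The exponential of a skew-symmetric matrix *)

Section MatrixExponential.
Variable R : realType.

Definition exp_poly (s : R) k : {poly R} := \poly_(l < k) exp_coeff s l.

(** Below degree [k] the truncation is invisible, and the coefficients are
    those of [exp (s1 X) exp (s2 X) = exp ((s1 + s2) X)]: binomial formula. *)
Lemma coef_exp_polyM (s1 s2 : R) k m : (m < k)%N ->
  (exp_poly s1 k * exp_poly s2 k)`_m = exp_coeff (s1 + s2) m.
Proof.
move=> lt_mk; rewrite coefM exp_coeffE addrC exprDn mulr_sumr.
apply: eq_bigr => -[i /= le_im] _; rewrite !coef_poly.
rewrite ltnS in le_im.
rewrite (leq_ltn_trans le_im lt_mk) (leq_ltn_trans (leq_subr _ _) lt_mk).
rewrite -[_ *+ 'C(m, i)]mulr_natl !exp_coeffE /= -(bin_fact le_im) !natrM.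
field.
by rewrite !pnatr_eq0 -!lt0n !fact_gt0 bin_gt0 le_im.
Qed.

(** A bound that also holds for the spurious coefficients of degree [k] or
    more; it makes them negligible, as a piece of the tail of an exponential
    series. *)
Lemma norm_coef_exp_polyM (s1 s2 : R) k m :
  `|(exp_poly s1 k * exp_poly s2 k)`_m| <= exp_coeff (`|s1| + `|s2|) m.
Proof.
rewrite -(@coef_exp_polyM _ _ m.+1) // !coefM.
apply: le_trans (ler_norm_sum _ _ _) _; apply: ler_sum => -[i /= le_im] _.
rewrite !coef_poly le_im ltnS leq_subr normrM !exp_coeffE /=.
have le1 (s : R) n j : `|if (j < n)%N then j`!%:R^-1 * s ^+ j else 0| <=
    j`!%:R^-1 * `|s| ^+ j.
  case: ifP => _; first by rewrite normrM normrX ger0_norm.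
  by rewrite normr0 mulr_ge0 ?exprn_ge0.
by apply: ler_pM.
Qed.

Variable n : nat.
Implicit Type M : 'M[R[i]]_n.+1.

Definition exp_sum M k : 'M[R[i]]_n.+1 :=
  \sum_(0 <= l < k) (l`!%:R)^-1 *: M ^+ l.

(* Evaluation at [M] is a ring morphism, which turns products of truncated
   exponentials into products of real polynomials. *)
Let evalp M (p : {poly R}) : 'M[R[i]]_n.+1 :=
  horner_mx M (map_poly (real_complex R) p).

Let evalpE M (p : {poly R}) k : (size p <= k)%N ->
  evalp M p = \sum_(l < k) (p`_l)%:C *: M ^+ l.
Proof.
move=> le_pk; have {1}-> : p = \poly_(l < k) p`_l.
  apply/polyP => l; rewrite coef_poly; case: ltnP => // le_kl.
  by rewrite nth_default // (leq_trans le_pk).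
rewrite poly_def /evalp !rmorph_sum /=; apply: eq_bigr => l _.
by rewrite map_polyZ map_polyXn horner_mxZ rmorphXn /= horner_mx_X.
Qed.

Lemma evalp_exp_poly M s k :
  evalp M (exp_poly s k) = \sum_(0 <= l < k) (exp_coeff s l)%:C *: M ^+ l.
Proof.
rewrite (@evalpE _ _ k) ?size_poly // big_mkord; apply: eq_bigr => l _.
by rewrite coef_poly ltn_ord.
Qed.

Lemma exp_sumE M k : exp_sum M k = evalp M (exp_poly 1 k).
Proof.
rewrite evalp_exp_poly; apply: eq_bigr => l _; congr (_ *: _).
by rewrite exp_coeffE /= expr1n mulr1 fmorphV rmorph_nat.
Qed.

Lemma trmxX M l : (M ^+ l)^T = M^T ^+ l.
Proof.
elim: l => [|l IHl]; first by rewrite !expr0 trmx1.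
by rewrite exprSr exprS -IHl; exact: trmx_mul.
Qed.

Lemma tr_exp_sum M k : M^T = - M -> (exp_sum M k)^T = evalp M (exp_poly (- 1) k).
Proof.
move=> MT; rewrite evalp_exp_poly linear_sum; apply: eq_bigr => l _ /=.
rewrite linearZ /= trmxX MT -scaleN1r exprZn scalerA; congr (_ *: _).
by rewrite exp_coeffE rmorphM /= fmorphV rmorph_nat rmorphXn rmorphN1.
Qed.

(** For skew [M] the transpose of the partial sum at [M] is the partial sum at
    [- M], so this is [exp (- M) exp M = 1] up to the truncation. *)
Lemma mnorm_exp_sum M k : (0 < k)%N -> M^T = - M ->
  mnorm ((exp_sum M k)^T *m exp_sum M k - 1%:M) <=
  n.+1%:R * (\sum_(k <= l < k.*2) exp_coeff (2 * mnorm M) l).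
Proof.
move=> k_gt0 MT; rewrite tr_exp_sum // exp_sumE.
have -> : evalp M (exp_poly (-1) k) *m evalp M (exp_poly 1 k)
   = evalp M (exp_poly (-1) k * exp_poly 1 k).
  by rewrite /evalp !rmorphM.
rewrite (@evalpE _ _ k.*2); last first.
  apply: leq_trans (size_polyMleq _ _) _; rewrite -addnn.
  by apply: leq_trans (leq_pred _) _; rewrite leq_add ?size_poly.
rewrite -(big_mkord xpredT
  (fun l => ((exp_poly (-1) k * exp_poly 1 k)`_l)%:C *: M ^+ l)).
rewrite (@big_cat_nat _ _ _ k) ?leq_addr -?addnn ?leq_addr //=.
rewrite (_ : \sum_(0 <= l < k) _ = 1%:M); last first.
  rewrite big_ltn // big_nat big1 => [|l /andP[l_gt0 lt_lk]];
    rewrite coef_exp_polyM // exp_coeffE addNr.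
    by rewrite addr0 fact0 invr1 !expr0 mul1r scale1r.
  by rewrite expr0n eqn0Ngt l_gt0 mulr0 scale0r.
rewrite [1%:M + _]addrC addrK.
have mnorm_sum (r : seq nat) (F : nat -> 'M[R[i]]_n.+1) :
    mnorm (\sum_(l <- r) F l) <= \sum_(l <- r) mnorm (F l).
  elim/big_rec2: _ => [|l y1 y2 _ le12]; first by rewrite mnorm0.
  by apply: le_trans (mnormD _ _) _; rewrite lerD2l.
apply: le_trans (mnorm_sum _ _) _; rewrite mulr_sumr; apply: ler_sum => l _.
rewrite mnormZ cmod_real.
apply: le_trans (ler_pM _ _ (norm_coef_exp_polyM _ _ _ _) (mnormX _ _)) _ => //.
  exact: mnorm_ge0.
rewrite normrN normr1 !exp_coeffE /= exprMn mulrCA.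
by rewrite !mulrA.
Qed.

(** The real and imaginary parts of each entry are real series dominated by
    that of [exp (mnorm M)]. *)
Lemma cvg_exp_sum M i j :
  ((fun k => exp_sum M k i j) : nat -> R[i]^o) @ \oo --> (expmx M i j : R[i]^o).
Proof.
pose u i j (k : nat) := k`!%:R^-1 * complex.Re ((M ^+ k) i j).
pose v i j (k : nat) := k`!%:R^-1 * complex.Im ((M ^+ k) i j).
have dominated (w : 'I_n.+1 -> 'I_n.+1 -> nat -> R) :
    (forall i j k, `|w i j k| <= cmod ((M ^+ k) i j)) ->
    forall i j, cvgn (series (fun k => k`!%:R^-1 * w i j k)).
  move=> le_w i' j'; apply: normed_cvg.
  apply: (@series_le_cvg _ _ (fun k => n.+1%:R * exp_coeff (mnorm M) k)) => k.
  - exact: normr_ge0.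
  - by rewrite mulr_ge0 // exp_coeff_ge0 // mnorm_ge0.
  - rewrite exp_coeffE /= normrM ger0_norm // mulrCA ler_wpM2l //.
    apply: le_trans (le_w _ _ _) _; apply: le_trans (mnormX _ _).
    exact: cmod_le_mnorm.
  - exact: (@is_cvg_seriesZ _ (exp_coeff (mnorm M)) n.+1%:R
      (@is_cvg_series_exp_coeff _ _)).
have cu := dominated _ (fun i j k => ge_Re_cmod ((M ^+ k) i j)).
have cv := dominated _ (fun i j k => ge_Im_cmod ((M ^+ k) i j)).
pose E := \matrix_(i, j) (limn (series (u i j)) +i* limn (series (v i j)))%C.
have entryE k a b : exp_sum M k a b =
    (series (u a b) k +i* series (v a b) k)%C.
  rewrite /exp_sum summxE /series /=; elim: k => [|k IHk].
    by rewrite !big_geq.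
  rewrite !big_nat_recr //= IHk mxE; apply/eqP; rewrite eq_complex /=.
  have -> : (k`!%:R : R[i])^-1 = (k`!%:R^-1)%:C by rewrite fmorphV rmorph_nat.
  rewrite /u /v; case: ((M ^+ k) a b) => x y /=.
  by rewrite !mul0r subr0 addr0 !eqxx.
have cE a b :
  ((fun k => exp_sum M k a b) : nat -> R[i]^o) @ \oo --> (E a b : R[i]^o).
  apply: cvg_complex; rewrite mxE /=.
    by under eq_fun do rewrite entryE /=; exact: cu.
  by under eq_fun do rewrite entryE /=; exact: cv.
by rewrite (expmx_lim cE); exact: cE.
Qed.

(** The deviation from orthogonality of a partial sum is controlled by a segment
    of the tail of a convergent series, by [mnorm_exp_sum]. *)
Lemma expmx_orth M : M^T = - M -> (expmx M)^T *m expmx M = 1%:M.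
Proof.
move=> MT; apply/matrixP => i j.
pose P k := (exp_sum M k)^T *m exp_sum M k.
have cP : ((fun k => P k i j) : nat -> R[i]^o) @ \oo -->
    (((expmx M)^T *m expmx M) i j : R[i]^o).
  rewrite mxE; under eq_fun do rewrite mxE.
  apply: (cvg_big (@add_continuous (R[i]^o : normedModType R[i]))) => l _.
  rewrite mxE; under eq_fun do rewrite mxE.
  exact: (@cvgM R[i] nat \oo _ _ _ _ _ (@cvg_exp_sum M l i) (@cvg_exp_sum M l j)).
apply: (cvg_unique _ cP); first exact: norm_hausdorff.
apply/cvgrPdist_lt => -[e e']; rewrite ltcE /= => /andP[/eqP-> e_gt0].
pose f := exp_coeff (2 * mnorm M).
have /cvgrPdist_lt c0 :
    (fun k => n.+1%:R * (series f k.*2 - series f k)) @ \oo --> (0 : R).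
  have cf : series f @ \oo --> limn (series f) by exact: is_cvg_series_exp_coeff.
  rewrite -(mulr0 n.+1%:R) -(subrr (limn (series f))); apply: cvgMl_tmp.
  apply: cvgB => //; apply: cvg_comp cf.
  apply/cvgnyPge => A; near=> k.
  by rewrite -addnn (leq_trans _ (leq_addl _ _)) //; near: k; exact: nbhs_infty_ge.
near=> k; rewrite distrC normr_cmod ltcR.
have k_gt0 : (0 < k)%N by near: k; exact: nbhs_infty_gt.
have -> : P k i j - 1%:M i j = (P k - 1%:M) i j.
  by rewrite [RHS]mxE; congr (_ + _); rewrite [RHS]mxE.
apply: le_lt_trans (cmod_le_mnorm (P k - 1%:M) i j) _.
apply: le_lt_trans (mnorm_exp_sum k_gt0 MT) _.
have : `|0 - n.+1%:R * (series f k.*2 - series f k)| < e by near: k; exact: c0.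
rewrite sub0r normrN; apply: le_lt_trans.
by rewrite sub_series_geq ?ler_norm // -addnn leq_addr.
Unshelve. all: by end_near. Qed.

End MatrixExponential.

(** * Skew two-step schemes and their invariant *)

Section BilinearForm.
Variables (R : realType) (n : nat).
Implicit Types (a b c : 'cV[R[i]]_n) (G P : 'M[R[i]]_n).

(** The bilinear, not the Hermitian, product: on [(v; w)] with [w] imaginary it
    is the Minkowski form, and complex skew matrices are infinitesimal
    isometries of it. *)
Definition cform a b : R[i] := (a^T *m b) 0 0.

Lemma cformC a b : cform a b = cform b a.
Proof. by rewrite /cform -[b^T *m a]trmxK trmx_mul trmxK [RHS]mxE. Qed.

Lemma cformDl a b c : cform (a + b) c = cform a c + cform b c.
Proof. by rewrite /cform linearD /= mulmxDl mxE. Qed.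

Lemma cformDr a b c : cform c (a + b) = cform c a + cform c b.
Proof. by rewrite cformC cformDl !(cformC c). Qed.

Lemma cformZl k a b : cform (k *: a) b = k * cform a b.
Proof. by rewrite /cform linearZ /= -scalemxAl mxE. Qed.

Lemma cformZr k a b : cform a (k *: b) = k * cform a b.
Proof. by rewrite cformC cformZl cformC. Qed.

Lemma cformNl a b : cform (- a) b = - cform a b.
Proof. by rewrite -scaleN1r cformZl mulN1r. Qed.

Lemma cformNr a b : cform a (- b) = - cform a b.
Proof. by rewrite cformC cformNl cformC. Qed.

Lemma cform_skew G a : G^T = - G -> cform a (G *m a) = 0.
Proof.
move=> GT; suff : cform a (G *m a) *+ 2 == 0 by rewrite mulrn_eq0 => /eqP.
by rewrite mulr2n addr_eq0 {1}cformC /cform trmx_mul GT mulmxN mulNmx mulmxA mxE.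
Qed.

Lemma cform_orth G a : G^T *m G = 1%:M -> cform (G *m a) (G *m a) = cform a a.
Proof. by move=> GG; rewrite /cform trmx_mul mulmxA -(mulmxA a^T) GG mulmx1. Qed.

Lemma cmod_cform a b : cmod (cform a b) <= mnorm a * mnorm b.
Proof.
apply: le_trans (cmod_le_mnorm (a^T *m b) 0 0) _.
by apply: le_trans (mnormM _ _) _; rewrite mnormT.
Qed.

(** If [a] is [b] up to a small perturbation [P b], and the square of [b] is
    [q0] up to [h ^ 2], then so is the square of [a].  Since [p <= 1 / 2], the
    vector [b] is bounded in terms of [a], hence by [2 m]. *)
Lemma cform_perturb a b G P (g p m : R) (h : R) q0 :
  a = b + P *m b ->
  cform b b = q0 - (h ^+ 2 / 4)%:C * cform (G *m b) (G *m b) ->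
  mnorm a <= m -> mnorm G <= g -> mnorm P <= p -> p <= 1 / 2 ->
  cmod (cform a a - q0) <= m ^+ 2 * (10 * p + h ^+ 2 * g ^+ 2).
Proof.
move=> aE bE le_am le_Gg le_Pp le_p.
have b_ge0 := mnorm_ge0 b; have P_ge0 := mnorm_ge0 P; have G_ge0 := mnorm_ge0 G.
have a_ge0 := mnorm_ge0 a.
have le_Pb : mnorm (P *m b) <= p * mnorm b.
  by apply: le_trans (mnormM _ _) _; rewrite ler_wpM2r.
have le_Gb : mnorm (G *m b) <= g * mnorm b.
  by apply: le_trans (mnormM _ _) _; rewrite ler_wpM2r.
have le_b : mnorm b <= 2 * m.
  have : mnorm b <= mnorm a + mnorm (P *m b).
    by rewrite -(mnormN (P *m b)) {1}(_ : b = a + - (P *m b)) ?mnormD // aE addrK.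
  by nra.
have le_form u1 u2 s1 s2 : mnorm u1 <= s1 -> mnorm u2 <= s2 ->
    cmod (cform u1 u2) <= s1 * s2.
  by move=> *; apply: le_trans (cmod_cform _ _) _; rewrite ler_pM ?mnorm_ge0.
have -> : cform a a - q0 = cform b (P *m b) + cform (P *m b) b
    + cform (P *m b) (P *m b) - (h ^+ 2 / 4)%:C * cform (G *m b) (G *m b).
  by rewrite aE !cformDl !cformDr bE; ring.
apply: le_trans (cmodB_le _ _) _; rewrite cmodM cmod_real.
have le3 :
    cmod (cform b (P *m b) + cform (P *m b) b + cform (P *m b) (P *m b)) <=
    mnorm b * (p * mnorm b) + (p * mnorm b) * mnorm b
    + (p * mnorm b) * (p * mnorm b).
  apply: le_trans (cmodD_le _ _) _; apply: lerD; last exact: le_form.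
  by apply: le_trans (cmodD_le _ _) _; apply: lerD; exact: le_form.
have le4 := le_form _ _ _ _ le_Gb le_Gb.
rewrite ger0_norm ?divr_ge0 ?sqr_ge0 //.
have hh : 0 <= h ^+ 2 / 4 by rewrite divr_ge0 ?sqr_ge0.
have := ler_wpM2l hh le4.
have le_b2 : mnorm b ^+ 2 <= 4 * m ^+ 2.
  have -> : 4 * m ^+ 2 = (2 * m) ^+ 2 by ring.
  by rewrite lerXn2r ?nnegrE // (le_trans b_ge0 le_b).
have p_ge0 : 0 <= p by exact: le_trans le_Pp.
(* [2 p + p ^ 2 <= 5 / 2 p] and [mnorm b ^ 2 <= 4 m ^ 2] give the factor 10. *)
have c_ge0 : 0 <= 5 / 2 * p + h ^+ 2 / 4 * g ^+ 2.
  by apply: addr_ge0; apply: mulr_ge0; rewrite ?sqr_ge0 // divr_ge0.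
have pb_ge0 : 0 <= mnorm b ^+ 2 * p by rewrite mulr_ge0 ?sqr_ge0.
have := ler_wpM2l c_ge0 le_b2; have := ler_wpM2l pb_ge0 le_p.
lra.
Qed.

End BilinearForm.

Section SkewSchemes.
Variables (R : realType) (n : nat) (h : R).
Implicit Types (u V : nat -> 'cV[R[i]]_n).

(** The second difference is proportional to the difference of the increments
    before and after step [k], and the first difference to their sum.  Skewness
    makes these orthogonal, so both increments have the same square. *)
Lemma increment_square u k (G : 'M[R[i]]_n) : h != 0 -> G^T = - G ->
  delta2 h u k = G *m delta1 h u k ->
  cform (u k.+1 - u k) (u k.+1 - u k) = cform (u k - u k.-1) (u k - u k.-1).
Proof.
move=> h0 GT uk; have := cform_skew (delta1 h u k) GT; rewrite -uk.
have c1 : (2 * h)^-1%:C != 0 :> R[i] by rewrite fmorph_eq0 invr_eq0 mulf_neq0.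
have c2 : (h ^+ 2)^-1%:C != 0 :> R[i] by rewrite fmorph_eq0 invr_eq0 expf_neq0.
rewrite /delta1 /delta2 cformZl cformZr => /eqP.
rewrite !mulf_eq0 (negbTE c1) (negbTE c2) /= => /eqP.
set p := u k.+1; set q := u k; set r := u k.-1.
rewrite -scaler_nat !(cformDl, cformDr, cformNl, cformNr, cformZl, cformZr).
rewrite (cformC r p) (cformC r q) (cformC q p) => E0.
apply/eqP; rewrite -subr_eq0 -E0; apply/eqP; ring.
Qed.

(** A two-step scheme for the positions [u], together with momenta [V]: the
    field enters through the skew matrices [G k], and [P k] measures how far
    the momentum is from the central difference. *)
Definition skew_scheme u V (G P : nat -> 'M[R[i]]_n) := forall k, (0 < k)%N ->
  [/\ (G k)^T = - G k,
      delta2 h u k = G k *m delta1 h u k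
    & V k = delta1 h u k + P k *m delta1 h u k].

(** Parallelogram identity for two consecutive increments, which by
    [increment_square] have the same square as the first one, [h p0]. *)
Lemma delta1_energy u V G P p0 : h != 0 -> u 1%N = u 0%N + h%:C *: p0 ->
  skew_scheme u V G P -> forall k, (0 < k)%N ->
  cform (delta1 h u k) (delta1 h u k) = cform p0 p0
    - (h ^+ 2 / 4)%:C * cform (G k *m delta1 h u k) (G k *m delta1 h u k).
Proof.
move=> h0 u1 uG k k_gt0.
have hC0 : (h%:C : R[i]) != 0 by rewrite fmorph_eq0.
have cons j : cform (u j.+1 - u j) (u j.+1 - u j) = h%:C ^+ 2 * cform p0 p0.
  elim: j => [|j IHj]; first by rewrite u1 addrC addKr cformZl cformZr; ring.
  by have [GT uGj _] := uG j.+1 isT; rewrite (increment_square h0 GT uGj).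
have [_ <- _] := uG k k_gt0.
have := cons k; have := cons k.-1; rewrite prednK // /delta1 /delta2.
set p := u k.+1; set q := u k; set r := u k.-1.
rewrite -scaler_nat !(cformDl, cformDr, cformNl, cformNr, cformZl, cformZr).
rewrite (cformC r p) (cformC r q) (cformC q p) => E1 E2.
have -> : cform p0 p0 = (h%:C ^- 2) / 2
    * ((h%:C ^+ 2 * cform p0 p0) + (h%:C ^+ 2 * cform p0 p0)).
  by field.
rewrite -{1}E1 -E2 !(rmorphM, fmorphV, rmorphXn, rmorph_nat) /=.
by field.
Qed.

End SkewSchemes.

(** * The methods as skew schemes *)

Section Lorentz.
Variable R : realType.
Implicit Types (T : 'M[R[i]]_3) (e a : 'cV[R[i]]_3) (b : R[i]).

(** [stack] with a complex first component; stacks of real positions are not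
    stable under the complex scalings that appear in the schemes. *)
Definition cstack a b : 'cV[R[i]]_4 := col_mx a (b%:M : 'M[R[i]]_1).

Lemma cstackZ k a b : k *: cstack a b = cstack (k *: a) (k * b).
Proof. by rewrite /cstack (scale_col_mx k a) scale_scalar_mx. Qed.

Lemma cstackD a1 a2 b1 b2 : cstack a1 b1 + cstack a2 b2 = cstack (a1 + a2) (b1 + b2).
Proof. by rewrite /cstack (add_col_mx a1 _ a2) -raddfD. Qed.

Lemma cstackB a1 a2 b1 b2 : cstack a1 b1 - cstack a2 b2 = cstack (a1 - a2) (b1 - b2).
Proof. by rewrite -scaleN1r cstackZ cstackD scaleN1r mulN1r. Qed.

(** The shape of [Fmx], with independent blocks: the matrices of all the
    schemes are of this form. *)
Definition lorentz T e : 'M[R[i]]_4 :=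
  block_mx T (- ('i%C *: e)) ('i%C *: e^T) (0 : 'M[R[i]]_1).

Lemma tr_lorentz T e : T^T = - T -> (lorentz T e)^T = - lorentz T e.
Proof.
move=> TT; rewrite /lorentz.
rewrite (tr_block_mx T (- ('i%C *: e)) ('i%C *: e^T) (0 : 'M[R[i]]_1)).
rewrite (opp_block_mx T (- ('i%C *: e)) ('i%C *: e^T) (0 : 'M[R[i]]_1)).
by rewrite TT trmx0 oppr0 linearN /= !linearZ /= trmxK opprK.
Qed.

Lemma lorentzM T e a b :
  lorentz T e *m cstack a b =
  cstack (T *m a - ('i%C * b) *: e) ('i%C * (e^T *m a) 0 0).
Proof.
rewrite /lorentz /cstack
  (mul_block_col T (- ('i%C *: e)) ('i%C *: e^T) (0 : 'M[R[i]]_1)).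
rewrite mul0mx addr0 mulNmx mul_mx_scalar scalerA [b * _]mulrC.
by rewrite -scalemxAl -scale_scalar_mx -mx11_scalar.
Qed.

Lemma lorentzD T1 T2 e1 e2 :
  lorentz (T1 + T2) (e1 + e2) = lorentz T1 e1 + lorentz T2 e2.
Proof.
rewrite /lorentz (add_block_mx T1 (- ('i%C *: e1)) ('i%C *: e1^T) (0 : 'M[R[i]]_1)).
by rewrite scalerDr opprD linearD /= scalerDr addr0.
Qed.

Lemma lorentzZ k T e : lorentz (k *: T) (k *: e) = k *: lorentz T e.
Proof.
rewrite /lorentz (scale_block_mx k T (- ('i%C *: e)) ('i%C *: e^T) (0 : 'M[R[i]]_1)).
by rewrite scaler0 !scalerN !linearZ /= !scalerA [k * _]mulrC.
Qed.

Lemma mnorm_lorentz T e : mnorm (lorentz T e) = mnorm T + 2 * mnorm e.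
Proof.
rewrite /lorentz (mnorm_block T (- ('i%C *: e)) ('i%C *: e^T) (0 : 'M[R[i]]_1)).
rewrite mnormN !mnormZ mnormT cmodi !mul1r.
by rewrite mnorm0; ring.
Qed.

Lemma tr_hatmx (b : 'cV[R]_3) : (hatmx b)^T = - hatmx b.
Proof.
apply/matrixP => i j; rewrite !mxE /= !andbT opprB.
(* Indices are in the group of integers modulo 3. *)
have add3 (k : 'I_3) : k + (1 + 2) = k.
  by rewrite (_ : 1 + 2 = 0) ?addr0 //; exact: val_inj.
have sw (k l : 'I_3) : (k + 1 == l) = (l + 2 == k).
  apply/eqP/eqP => <-; rewrite -addrA ?add3 //.
  by rewrite [2 + 1]addrC add3.
have sw2 (k l : 'I_3) : l + 2 = k -> k + 2 = l + 1.
  by move=> <-; rewrite -addrA; congr (_ + _); exact: val_inj.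
rewrite !sw; congr (_ - _); case: eqP => [e|_]; rewrite ?mul0r //.
  by rewrite (sw2 _ _ e).
by rewrite (sw2 _ _ e).
Qed.

Lemma mnorm_hatmx (b : 'cV[R]_3) m : (forall i, `|b i 0| <= m) ->
  mnorm (toC (hatmx b)) <= m *+ 18.
Proof.
move=> le_bm.
(* Nine entries, each a difference of two terms. *)
apply: (@le_trans _ _ ((m *+ 2) *+ (3 * 3))); last by rewrite -mulrnA.
apply: mnorm_le => i j; rewrite mxE cmod_real !mxE /= !andbT.
apply: le_trans (ler_normB _ _) _; rewrite mulr2n !normrM.
have m_ge0 : 0 <= m by exact: le_trans (normr_ge0 _) (le_bm 0).
by apply: lerD; case: eqP => _; rewrite ?normr1 ?normr0 ?mul1r ?mul0r ?le_bm.
Qed.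

Lemma mnorm_toC (b : 'cV[R]_3) m :
  (forall i, `|b i 0| <= m) -> mnorm (toC b) <= m *+ 3.
Proof. by move=> le_bm; apply: mnorm_le => i j; rewrite mxE cmod_real ord1. Qed.

Lemma delta1_stack (x : nat -> 'cV[R]_3) (t : nat -> R[i]) h n :
  delta1 h (fun k => stack (x k) (t k)) n =
   cstack (delta1 h (fun k => toC (x k)) n) (delta1 h (t : nat -> R[i]^o) n).
Proof.
rewrite /delta1 -[stack (x n.+1) _]/(cstack (toC (x n.+1)) (t n.+1)).
by rewrite -[stack (x n.-1) _]/(cstack (toC (x n.-1)) (t n.-1)) cstackB cstackZ.
Qed.

Lemma delta2_stack (x : nat -> 'cV[R]_3) (t : nat -> R[i]) h n :
  delta2 h (fun k => stack (x k) (t k)) n =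
   cstack (delta2 h (fun k => toC (x k)) n) (delta2 h (t : nat -> R[i]^o) n).
Proof.
rewrite /delta2 -[stack (x n.+1) _]/(cstack (toC (x n.+1)) (t n.+1)).
rewrite -[stack (x n.-1) _]/(cstack (toC (x n.-1)) (t n.-1)).
rewrite -[stack (x n) _]/(cstack (toC (x n)) (t n)) !mulr2n.
by rewrite cstackD cstackB cstackD cstackZ.
Qed.

Lemma mass_shellE (v : 'cV[R]_3) w :
  mass_shell v w = 2^-1 * cform (stack v w) (stack v w).
Proof.
rewrite /mass_shell /cform /stack (tr_col_mx (toC v) (w%:M : 'M[R[i]]_1)).
rewrite (mul_row_col (toC v)^T _ (toC v)) mxE (addrC (w ^+ 2)); congr (_ * (_ + _)).
  by rewrite /dot /toC map_trmx -map_mxM [RHS]mxE.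
by rewrite tr_scalar_mx -scalar_mxM mxE eqxx.
Qed.

End Lorentz.

Section Schemes.
Variable R : realType.
Variables (A : 'cV[R]_3 -> 'cV[R]_3) (U : 'cV[R]_3 -> R).

Lemma FmxE y : Fmx A U y = lorentz (Bt A y) (EC U y).
Proof. by []. Qed.

Lemma tr_toC_hatmx (b : 'cV[R]_3) : (toC (hatmx b))^T = - toC (hatmx b).
Proof. by rewrite /toC map_trmx tr_hatmx map_mxN. Qed.

Lemma tr_Fmx y : (Fmx A U y)^T = - Fmx A U y.
Proof. by rewrite tr_lorentz // tr_toC_hatmx. Qed.

Lemma expF_orth h y : (expF A U h y)^T *m expF A U h y = 1%:M.
Proof. by apply: expmx_orth; rewrite linearZ /= tr_Fmx scalerN. Qed.

Variables (x0 : 'cV[R]_3) (t0 : R[i]) (v0 : 'cV[R]_3) (w0 : R[i]) (h : R).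
Variables (x : nat -> 'cV[R]_3) (t : nat -> R[i]).
Variables (v : nat -> 'cV[R]_3) (w : nat -> R[i]).

Let X n := stack (x n) (t n).
Let V n := stack (v n) (w n).

Lemma method1_mass_shell : method1 A U x0 t0 v0 w0 h x t v w ->
  forall n, mass_shell (v n.+1) (w n.+1) = mass_shell (v n) (w n).
Proof.
by case=> _ _ Hv n; rewrite !mass_shellE Hv !cform_orth // expF_orth.
Qed.

Let S1 := K1 A U h x0.
Let S2 := K2 A U h x0.
Let S3 := K3 A U h x0.
Let S4 := K4 A U h x0.

(** The second scheme mixes the fields at [x0] and at [y]; its matrix is
    nevertheless skew. *)
Definition force_mx2 y : 'M[R[i]]_4 := (2 / h)%:C *:
  lorentz (S1 *: Bt A y + S2 *: Et U y) (S1 *: EC U y - S2 *: BC A x0).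

(** The momentum of the second scheme is [S3 + S4 F ^ 2] applied to the central
    difference. *)
Definition momentum_mx2 y : 'M[R[i]]_4 :=
  (S3 - 1)%:M + S4 *: (Fmx A U y *m Fmx A U y).

Definition force_mx3 y : 'M[R[i]]_4 := ((2 / h)%:C * S1) *: Fmx A U y.

Lemma method2_scheme : method2 A U x0 t0 v0 w0 h x t v w ->
  skew_scheme h X V (fun n => force_mx2 (x n)) (fun n => momentum_mx2 (x n)).
Proof.
case=> _ + + n n_gt0 => /(_ n n_gt0)[HDx HDt] /(_ n n_gt0)[Hv Hw].
split.
- rewrite /force_mx2 linearZ /= tr_lorentz ?scalerN //.
  by rewrite linearD /= !linearZ /= !tr_toC_hatmx !scalerN opprD.
- rewrite delta2_stack delta1_stack /force_mx2 -scalemxAl lorentzM cstackZ.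
  rewrite HDx HDt; congr cstack.
    by rewrite [RHS]scalerBr [in RHS]scalerA -[in LHS]mulrA.
  by rewrite linearB /= !linearZ /= -[in LHS]mulrA.
- rewrite /momentum_mx2 mulmxDl mul_scalar_mx scalerBl scale1r -scalemxAl -mulmxA.
  rewrite delta1_stack !FmxE !lorentzM !(cstackZ, cstackB, cstackD).
  rewrite /V /stack Hv Hw -/S3 -/S4 -[col_mx _ _]/(cstack _ _).
  set a := delta1 h (fun k => toC (x k)) n.
  set b : R[i] := delta1 h (t : nat -> R[i]^o) n.
  set T := Bt A _; set e := EC U _; clearbody a b T e.
  have ii : 'i%C * 'i%C = -1 :> R[i] by rewrite -expr2 sqr_i.
  have Tae : T *m (T *m a - ('i%C * b) *: e) =
      T *m (T *m a) - ('i%C * b) *: (T *m e) by rewrite mulmxBr -scalemxAr.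
  have eea : e *m e^T *m a = (e^T *m a) 0 0 *: e.
    by rewrite -mulmxA [e^T *m a in LHS]mx11_scalar mul_mx_scalar.
  congr cstack.
    rewrite addrA [a + _]addrC subrK Tae mulmxDl mul_scalar_mx -scalemxAl.
    rewrite mulmxDl eea -mulmxA mulrA ii mulN1r scaleNr opprK -addrA.
    congr (_ + _); rewrite !scalerDr scalerN -!addrA; congr (_ + _).
    by rewrite [RHS]addrC; congr (_ - _); rewrite [RHS]scalerA mulrCA mulrA.
  rewrite addrA [b + _]addrC subrK mulmxBr -scalemxAr mulmxA.
  set s := (e^T *m T *m a) 0 0; set r := (e^T *m e) 0 0.
  have -> : (e^T *m T *m a - ('i%C * b) *: (e^T *m e)) 0 0 = s - 'i%C * b * r.
    rewrite [LHS]mxE; congr (_ + _).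
    by rewrite [LHS]mxE; congr (- _); rewrite [LHS]mxE.
  have -> : S4 * ('i%C * (s - 'i%C * b * r)) =
      S4 * 'i%C * s - S4 * ('i%C * 'i%C) * b * r by ring.
  rewrite ii; ring.
Qed.

Lemma method3_scheme : method3 A U x0 t0 v0 w0 h x t v w ->
  skew_scheme h X V (fun n => force_mx3 (x n)) (fun n => (S3 - 1)%:M).
Proof.
case=> _ + + n n_gt0 => /(_ n n_gt0)[HDx HDt] /(_ n n_gt0)[Hv Hw].
split.
- by rewrite linearZ /= tr_Fmx scalerN.
- rewrite delta2_stack delta1_stack /force_mx3 -scalemxAl FmxE lorentzM.
  rewrite HDx HDt cstackZ.
  by congr cstack; rewrite [RHS]mulrA; congr (_ * _); rewrite mulrAC.
- rewrite mul_scalar_mx scalerBl scale1r addrCA subrr addr0.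
  by rewrite delta1_stack cstackZ /V /stack Hv Hw.
Qed.

Lemma method4_scheme : method4 A U x0 t0 v0 w0 h x t v w ->
  skew_scheme h X V (fun n => Fmx A U (x n)) (fun n => 0).
Proof.
case=> _ + + n n_gt0 => /(_ n n_gt0)[HDx HDt] /(_ n n_gt0)[Hv Hw].
split; first exact: tr_Fmx.
- by rewrite delta2_stack delta1_stack FmxE lorentzM HDx HDt.
- by rewrite mul0mx addr0 delta1_stack /V /stack Hv Hw.
Qed.

End Schemes.

(** * Asymptotics of the coefficients for small steps *)

Section SmallSteps.
Variable R : realType.
Implicit Types (f g : R -> R[i]) (s : R[i]).

(** [f h = O(h ^ k)] as [h] decreases to 0.  The values are complex and the
    gauge real, whence this direct formulation. *)
Definition Oh (k : nat) f :=
  exists c : R, \forall h \near 0^'+, cmod (f h) <= c * h ^+ k.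

Lemma near_eq_Oh k f g : (\forall h \near 0^'+, f h = g h) -> Oh k f -> Oh k g.
Proof.
move=> fg [c cf]; exists c.
near=> h; have <- : f h = g h by near: h.
by near: h.
Unshelve. all: by end_near. Qed.

Lemma OhD k f g : Oh k f -> Oh k g -> Oh k (f \+ g).
Proof.
move=> [c cf] [d dg]; exists (c + d); near=> h.
apply: le_trans (cmodD_le _ _) _; rewrite mulrDl; apply: lerD.
  by near: h.
by near: h.
Unshelve. all: by end_near. Qed.

Lemma OhM j k f g : Oh j f -> Oh k g -> Oh (j + k) (f \* g).
Proof.
move=> [c cf] [d dg]; exists (c * d); near=> h.
rewrite cmodM exprD mulrACA; apply: ler_pM; rewrite ?cmod_ge0 //; near: h.
Unshelve. all: by end_near. Qed.

Lemma Oh_cst s : Oh 0 (fun=> s).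
Proof.
by exists (cmod s); near=> h; rewrite expr0 mulr1.
Unshelve. all: by end_near. Qed.

Lemma OhZ k s f : Oh k f -> Oh k (fun h => s * f h).
Proof. by move=> Of; exact: (OhM (Oh_cst s) Of). Qed.

Lemma OhB k f g : Oh k f -> Oh k g -> Oh k (fun h => f h - g h).
Proof.
move=> Of /(OhZ (-1)) Og; apply: near_eq_Oh (OhD Of Og).
by near=> h; rewrite /= mulN1r.
Unshelve. all: by end_near. Qed.

Lemma Oh_kk : Oh 1 (@kk R).
Proof.
exists (1 / 2); near=> h; rewrite /kk cmod_real expr1 ger0_norm.
  by rewrite mulrC mul1r.
by rewrite divr_ge0.
Unshelve. all: by end_near. Qed.

(** Difference quotients that converge are bounded. *)
Lemma derivable_lip (f : R -> R) : derivable f 0 1 ->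
  exists c, \forall y \near 0, `|f y - f 0| <= c * `|y|.
Proof.
move=> /cvg_ex[l /cvgrPdist_lt/(_ 1 ltr01)] => near_l.
exists (`|l| + 1).
have : \forall y \near (0 : R), y != 0 ->
    `|l - y^-1 *: ((f \o shift 0) (y *: 1) - f 0)| < 1.
  exact: near_l.
apply: filterS => y; have [->|y0 /(_ isT) lt1] := eqVneq y 0.
  by rewrite subrr normr0 mulr0.
move: lt1; rewrite /= addr0 => lt1.
have -> : f y - f 0 = y * (y^-1 * (f (y * 1) - f 0)) by rewrite mulr1 mulVKf.
rewrite normrM mulrC ler_wpM2r // -lerBlDl (le_trans _ (ltW lt1)) //.
by rewrite distrC; exact: lerB_dist.
Qed.

Lemma Oh_cexp s : Oh 1 (fun h => cexp (kk h * s) - 1).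
Proof.
case: s => a b.
have [ce le_e] := derivable_lip (@derivable_expR R 0).
have [cc le_c] := derivable_lip (@ex_derive _ _ _ _ _ _ _ (is_derive_cos (0 : R))).
have [cs le_s] := derivable_lip (@ex_derive _ _ _ _ _ _ _ (is_derive_sin (0 : R))).
have sub (l : R) (P : R -> Prop) : (\forall y \near 0, P y) ->
    \forall h \near 0^'+, P (h / 2 * l).
  move=> nP; suff : (fun h : R => h / 2 * l) @ 0^'+ --> (0 : R) by apply.
  apply: cvg_at_right_filter; rewrite -[X in _ --> X](mul0r l) -{2}(mul0r 2^-1).
  by apply: cvgM; [apply: cvgM; [exact: cvg_id|exact: cvg_cst]|exact: cvg_cst].
exists (ce * (`|a| / 2) + (cc * (`|b| / 2) + cs * (`|b| / 2))).
near=> h.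
have h_gt0 : 0 < h by near: h; exact: nbhs_right_gt.
have nE l : `|h / 2 * l| = `|l| / 2 * h.
  by rewrite normrM ger0_norm ?divr_ge0 ?ltW //; ring.
have -> : cexp (kk h * (a +i* b)%C) - 1 =
   (expR (h / 2 * a) - 1)%:C * (cos (h / 2 * b) +i* sin (h / 2 * b))%C
   + ((cos (h / 2 * b) - 1)%:C + 'i%C * (sin (h / 2 * b))%:C).
  rewrite /cexp /kk /= !mul0r subr0 addr0.
  by apply/eqP; rewrite eq_complex /=; apply/andP; split; apply/eqP; ring.
rewrite expr1 !mulrDl; apply: le_trans (cmodD_le _ _) _; apply: lerD.
  rewrite cmodM cmod_real /= cos2Dsin2 sqrtr1 mulr1.
  suff : `|expR (h / 2 * a) - expR 0| <= ce * `|h / 2 * a|.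
    by rewrite expR0 nE mulrA.
  by near: h; exact: (sub a _ le_e).
apply: le_trans (cmodD_le _ _) _; apply: lerD.
  suff : `|cos (h / 2 * b) - cos 0| <= cc * `|h / 2 * b|.
    by rewrite cos0 nE mulrA cmod_real.
  by near: h; exact: (sub b _ le_c).
suff : `|sin (h / 2 * b) - sin 0| <= cs * `|h / 2 * b|.
  by rewrite sin0 subr0 nE mulrA cmodM cmodi mul1r cmod_real.
by near: h; exact: (sub b _ le_s).
Unshelve. all: by end_near. Qed.

Lemma cexpNK z : cexp z * cexp (- z) = 1 :> R[i].
Proof.
case: z => a b; rewrite /cexp /= cosN sinN expRN.
have e0 : expR a != 0 by rewrite gt_eqF ?expR_gt0.
apply/eqP; rewrite eq_complex /= !mul0r !subr0 !addr0; apply/andP; split; apply/eqP.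
  by rewrite -[RHS](cos2Dsin2 b); field.
by field.
Qed.

(** [cosh z - 1 = - (e ^ z - 1) (e ^ (- z) - 1) / 2]: two factors of order 1. *)
Lemma Oh_ccosh s : Oh 2 (fun h => ccosh (kk h * s) - 1).
Proof.
have := OhZ (- 2^-1) (OhM (Oh_cexp s) (Oh_cexp (- s))).
apply: near_eq_Oh; near=> h; rewrite /ccosh /= mulrN.
have E := cexpNK (kk h * s); rewrite mulrBl !mulrBr E.
by field.
Unshelve. all: by end_near. Qed.

Lemma Oh_csinh s : Oh 1 (fun h => csinh (kk h * s)).
Proof.
have := OhZ 2^-1 (OhB (Oh_cexp s) (Oh_cexp (- s))).
by apply: near_eq_Oh; near=> h; rewrite /csinh /= mulrN; field.
Unshelve. all: by end_near. Qed.

Lemma near_ccosh_ge s : \forall h \near 0^'+, 1 / 2 <= cmod (ccosh (kk h * s)).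
Proof.
have [c le_c] := Oh_ccosh s.
have c0 : (fun h : R => c * h ^+ 2) @ 0^'+ --> (0 : R).
  have E : c * 0 ^+ 2 = 0 :> R by rewrite expr0n mulr0.
  apply: cvg_at_right_filter; rewrite -[X in _ --> X]E.
  by apply: cvgMl_tmp; exact: exprn_continuous.
have /cvgrPdist_lt/(_ (1 / 2)) near_c := c0.
near=> h.
have : `|0 - c * h ^+ 2| < 1 / 2 by near: h; apply: near_c.
rewrite sub0r normrN => /(le_lt_trans (ler_norm _)) lt_c.
have le1 : cmod (ccosh (kk h * s) - 1) <= c * h ^+ 2 by near: h.
have := cmodB_le (ccosh (kk h * s)) (ccosh (kk h * s) - 1).
rewrite opprB addrC subrK cmod1; lra.
Unshelve. all: by end_near. Qed.

Lemma Oh_csech0 s : Oh 0 (fun h => csech (kk h * s)).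
Proof.
exists 2; near=> h; rewrite expr0 mulr1 /csech cmodV.
have ge2 : 1 / 2 <= cmod (ccosh (kk h * s)) by near: h; exact: near_ccosh_ge.
by rewrite -[leRHS]invrK lef_pV2 ?posrE ?invr_gt0 ?(lt_le_trans _ ge2) // -div1r.
Unshelve. all: by end_near. Qed.

Lemma Oh_csech s : Oh 2 (fun h => csech (kk h * s) - 1).
Proof.
have := OhZ (-1) (OhM (Oh_csech0 s) (Oh_ccosh s)); apply: near_eq_Oh; near=> h => /=.
have ge2 : 1 / 2 <= cmod (ccosh (kk h * s)) by near: h; exact: near_ccosh_ge.
have n0 : ccosh (kk h * s) != 0.
  by apply/eqP => E; move: ge2; rewrite E cmod0; lra.
by rewrite /csech; field.
Unshelve. all: by end_near. Qed.

Lemma Oh_ctanh s : Oh 1 (fun h => ctanh (kk h * s)).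
Proof. exact: (OhM (Oh_csinh s) (Oh_csech0 s)). Qed.

End SmallSteps.

(** The arguments [sq1] and [sq2] are fixed complex numbers, so each coefficient
    is a fixed linear combination of hyperbolic functions of multiples of [h]. *)
Section Coefficients.
Variables (R : realType) (A : 'cV[R]_3 -> 'cV[R]_3) (U : 'cV[R]_3 -> R).
Variable x0 : 'cV[R]_3.

Lemma Oh_K1 : Oh 1 (fun h => K1 A U h x0).
Proof.
rewrite /K1; case: eqP => _; first exact: Oh_kk.
have := OhZ (dd A U x0)%:C^-1 (OhB (OhZ (sq1 A U x0) (Oh_ctanh (sq1 A U x0)))
  (OhZ (sq2 A U x0) (Oh_ctanh (sq2 A U x0)))).
by apply: near_eq_Oh; near=> h; rewrite mulrC.
Unshelve. all: by end_near. Qed.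

Lemma Oh_tanh_div (s : R[i]) : Oh 1 (fun h => tanh_div h s).
Proof.
rewrite /tanh_div; case: eqP => _; first exact: Oh_kk.
by apply: near_eq_Oh (OhZ s^-1 (Oh_ctanh s)); near=> h; rewrite mulrC.
Unshelve. all: by end_near. Qed.

Lemma Oh_K2 : Oh 1 (fun h => K2 A U h x0).
Proof.
rewrite /K2; case: eqP => _; last by apply: OhZ; apply: OhB; exact: Oh_tanh_div.
by exists 0; near=> h; rewrite cmod0 mul0r.
Unshelve. all: by end_near. Qed.

Lemma Oh_K3 : Oh 2 (fun h => K3 A U h x0 - 1).
Proof.
rewrite /K3; case: eqP => _.
  by exists 0; near=> h; rewrite subrr cmod0 mul0r.
(* The two weights sum to 1, so each sech can be compared with 1 separately. *)
set a := r1 A U x0 / _.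
have := OhD (OhZ (2^-1 * (1 - a)%:C) (Oh_csech (sq1 A U x0)))
            (OhZ (2^-1 * (1 + a)%:C) (Oh_csech (sq2 A U x0))).
by apply: near_eq_Oh; near=> h; rewrite /= rmorphB rmorphD rmorph1; field.
Unshelve. all: by end_near. Qed.

Lemma Oh_K4 : Oh 2 (fun h => K4 A U h x0).
Proof.
rewrite /K4; case: eqP => _.
  have := OhZ (- 2^-1) (OhM (Oh_kk R) (Oh_kk R)).
  by apply: near_eq_Oh; near=> h; rewrite /= -expr2 mulNr mulrC.
have := OhZ (dd A U x0)%:C^-1 (OhB (Oh_csech (sq1 A U x0)) (Oh_csech (sq2 A U x0))).
by apply: near_eq_Oh; near=> h; rewrite opprB addrA subrK mulrC.
Unshelve. all: by end_near. Qed.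

End Coefficients.

(** * Near-conservation of the mass shell *)

Section NearConservation.
Variable R : realType.
Variables (A : 'cV[R]_3 -> 'cV[R]_3) (U : 'cV[R]_3 -> R).

Section Bounds.
Variables (b : R) (y : 'cV[R]_3).
Hypothesis le_B : forall i, `|Bf A y i 0| <= b.
Hypothesis le_E : forall i, `|Ef U y i 0| <= b.

(** 18 from the skew block, and 3 from each of the two copies of [EC]. *)
Lemma mnorm_Fmx : mnorm (Fmx A U y) <= 24 * b.
Proof.
rewrite mnorm_lorentz; have := mnorm_hatmx le_B; have := mnorm_toC le_E.
rewrite -!(mulr_natl b) /Bt /EC; lra.
Qed.

Lemma mnorm_force_mx2 x0 h c : 0 < h -> (forall i, `|Bf A x0 i 0| <= b) ->
  cmod (K1 A U h x0) <= c * h -> cmod (K2 A U h x0) <= c * h ->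
  mnorm (force_mx2 A U x0 h y) <= 96 * c * b.
Proof.
move=> h_gt0 le_B0 le_1 le_2; rewrite /force_mx2 mnormZ cmod_real.
rewrite -scalerN lorentzD !lorentzZ.
have mB0 := mnorm_toC le_B0; have mB := mnorm_hatmx le_B.
have mE := mnorm_toC le_E; have mEt := mnorm_hatmx le_E.
have h0 : h != 0 by rewrite gt_eqF.
have b_ge0 : 0 <= b by exact: le_trans (normr_ge0 _) (le_B 0).
have m1 : mnorm (lorentz (Bt A y) (EC U y)) <= 24 * b by exact: mnorm_Fmx.
have m2 : mnorm (lorentz (Et U y) (- BC A x0)) <= 24 * b.
  rewrite mnorm_lorentz mnormN; move: mB0 mEt.
  by rewrite -!(mulr_natl b) /Et /BC; lra.
have -> : 96 * c * b = `|2 / h| * ((c * h) * (24 * b) + (c * h) * (24 * b)).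
  by rewrite ger0_norm ?divr_ge0 ?ltW //; field.
apply: ler_wpM2l; first exact: normr_ge0.
apply: (le_trans (mnormD (_ *: lorentz (Bt A y) _) (_ *: lorentz (Et U y) _))).
rewrite (mnormZ _ (lorentz (Bt A y) _)) (mnormZ _ (lorentz (Et U y) _)).
have step (z : R[i]) (M : 'M[R[i]]_4) : cmod z <= c * h -> mnorm M <= 24 * b ->
    cmod z * mnorm M <= c * h * (24 * b).
  by apply: ler_pM; [exact: cmod_ge0 | exact: mnorm_ge0].
by apply: lerD; [exact: step le_1 m1 | exact: step le_2 m2].
Qed.

Lemma mnorm_momentum_mx2 x0 h c :
  cmod (K3 A U h x0 - 1) <= c * h ^+ 2 -> cmod (K4 A U h x0) <= c * h ^+ 2 ->
  mnorm (momentum_mx2 A U x0 h y) <= c * (4 + (24 * b) ^+ 2) * h ^+ 2.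
Proof.
move=> le_3 le_4; apply: le_trans (mnormD _ _) _.
rewrite -scalemx1 !mnormZ mnorm1.
have -> : c * (4 + (24 * b) ^+ 2) * h ^+ 2 =
    c * h ^+ 2 * 4 + c * h ^+ 2 * (24 * b) ^+ 2 by ring.
apply: lerD; first by rewrite ler_wpM2r.
apply: ler_pM; rewrite ?cmod_ge0 ?mnorm_ge0 //.
apply: le_trans (mnormM _ _) _; rewrite expr2.
by apply: ler_pM; rewrite ?mnorm_ge0 //; exact: mnorm_Fmx.
Qed.

End Bounds.

(** The starting step makes the first increment [h] times an isometric image of
    the initial momentum, so the conserved square is that of [(v0; w0)]. *)
Lemma scheme_mass_shell (x0 : 'cV[R]_3) (t0 : R[i]) (v0 : 'cV[R]_3) (w0 : R[i]) h
    (x : nat -> 'cV[R]_3) (t : nat -> R[i]) (v : nat -> 'cV[R]_3) (w : nat -> R[i])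
    (G P : nat -> 'M[R[i]]_4) (g p m : R) n :
  0 < h -> starting A U x0 t0 v0 w0 h x t v w ->
  skew_scheme h (fun j => stack (x j) (t j)) (fun j => stack (v j) (w j)) G P ->
  (0 < n)%N -> mnorm (stack (v n) (w n)) <= m ->
  mnorm (G n) <= g -> mnorm (P n) <= p -> p <= 1 / 2 ->
  cmod (mass_shell (v n) (w n) - mass_shell (v 0%N) (w 0%N)) <=
    m ^+ 2 * (10 * p + h ^+ 2 * g ^+ 2).
Proof.
move=> h_gt0 [[x0E t0E v0E w0E] X1 _] sch n_gt0 le_m le_g le_p p2.
have [_ _ VE] := sch n n_gt0.
set X := (fun j => stack (x j) (t j)) in sch VE.
have X1' : X 1%N = X 0%N + h%:C *: (expF A U h x0 *m stack (v 0%N) (w 0%N)).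
  by rewrite /X X1 x0E t0E v0E w0E.
have energy := delta1_energy (lt0r_neq0 h_gt0) X1' sch n_gt0.
rewrite cform_orth ?expF_orth // in energy.
rewrite !mass_shellE -mulrBr cmodM cmodV cmod_nat.
have := cform_perturb VE energy le_m le_g le_p p2.
have := cmod_ge0 (cform (stack (v n) (w n)) (stack (v n) (w n)) -
  cform (stack (v 0%N) (w 0%N)) (stack (v 0%N) (w 0%N))).
lra.
Qed.

Lemma compact_bound (T : topologicalType) (K : set T) (f : T -> R) :
  compact K -> continuous f -> exists2 M, 0 <= M & forall p, K p -> `|f p| <= M.
Proof.
move=> cK cf.
have /compact_bounded/ex_strict_bound_gt0[M M_gt0 bM] : compact (f @` K).
  by apply: continuous_compact => //; exact: continuous_subspaceT.
exists M; first exact: ltW.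
by move=> p Kp; apply/ltW/bM; exists p.
Qed.

Lemma smooth_partial (f : 'cV[R]_3 -> R) j : smooth f -> continuous (partial j f).
Proof. by move=> /(_ [:: j])[]. Qed.

Lemma compact_bound_col (T : topologicalType) (K : set T) (f : 'I_3 -> T -> R) :
  compact K -> (forall i, continuous (f i)) ->
  exists2 M, 0 <= M & forall p i, K p -> `|f i p| <= M.
Proof.
move=> cK cf; have /choice[M bM] : forall i, exists M,
    0 <= M /\ forall p, K p -> `|f i p| <= M.
  by move=> i; have [M ? ?] := compact_bound cK (cf i); exists M.
exists (\sum_i M i); first by apply: sumr_ge0 => i _; have [] := bM i.
move=> p i Kp; apply: (@le_trans _ _ (M i)); first by have [_] := bM i; apply.
by rewrite (bigD1 i) //= lerDl sumr_ge0 // => j _; have [] := bM j.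
Qed.

Lemma state_bound (K : set ('cV[R]_3 * 'cV[R]_3 * R)) : compact K ->
  smooth_field A -> smooth U ->
  exists b, [/\ 0 <= b & forall y v g, K (y, v, g) ->
    [/\ forall i, `|Bf A y i 0| <= b, forall i, `|Ef U y i 0| <= b,
     forall i, `|v i 0| <= b & `|g| <= b]].
Proof.
move=> cK sA sU.
have cfst : continuous (fun p : 'cV[R]_3 * 'cV[R]_3 * R => p.1.1).
  by move=> p; apply: continuous_comp; exact: cvg_fst.
have csnd : continuous (fun p : 'cV[R]_3 * 'cV[R]_3 * R => p.1.2).
  by move=> p; apply: continuous_comp; [exact: cvg_fst|exact: cvg_snd].
have ccomp (g : 'cV[R]_3 -> R) (q : 'cV[R]_3 * 'cV[R]_3 * R -> 'cV[R]_3) :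
  continuous q -> continuous g -> continuous (g \o q).
  by move=> cq cg p; apply: continuous_comp; [exact: cq|exact: cg].
have [b1 b1_ge0 le_b1] : exists2 M, 0 <= M &
    forall p i, K p -> `|Bf A p.1.1 i 0| <= M.
  apply: (compact_bound_col cK) => i.
  apply: (ccomp (fun y => Bf A y i 0) _ cfst) => y.
  have -> : (fun y => Bf A y i 0) = (partial (i + 1) (fun y => A y (i + 2) 0)
          \- partial (i + 2) (fun y => A y (i + 1) 0)).
    by apply/funext => z; rewrite mxE.
  apply: (@continuousB R R^o).
    exact: (@smooth_partial _ (i + 1) (sA (i + 2)) y).
  exact: (@smooth_partial _ (i + 2) (sA (i + 1)) y).
have [b2 b2_ge0 le_b2] : exists2 M, 0 <= M &
    forall p i, K p -> `|Ef U p.1.1 i 0| <= M.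
  apply: (compact_bound_col cK) => i.
  apply: (ccomp (fun y => Ef U y i 0) _ cfst) => y.
  have -> : (fun y => Ef U y i 0) = \- partial i U.
    by apply/funext => z; rewrite !mxE.
  by apply: (@continuousN R R^o); exact: (@smooth_partial _ i sU y).
have [b3 b3_ge0 le_b3] : exists2 M, 0 <= M &
    forall p i, K p -> `|p.1.2 i 0| <= M.
  apply: (compact_bound_col cK) => i; apply: (ccomp (fun y => y i 0) _ csnd) => y.
  exact: coord_continuous.
have [b4 b4_ge0 le_b4] : exists2 M, 0 <= M & forall p, K p -> `|p.2| <= M.
  by apply: (compact_bound cK) => p; exact: cvg_snd.
exists (b1 + b2 + b3 + b4); split; first by rewrite !addr_ge0.
move=> y v g Kp; split=> [i|i|i|].
- by have := le_b1 _ i Kp; rewrite /=; lra.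
- by have := le_b2 _ i Kp; rewrite /=; lra.
- by have := le_b3 _ i Kp; rewrite /=; lra.
- by have := le_b4 _ Kp; rewrite /=; lra.
Qed.

Lemma mnorm_stack (v : 'cV[R]_3) (w : R[i]) b : (forall i, `|v i 0| <= b) ->
  imaginary w -> `|complex.Im w| <= b -> mnorm (stack v w) <= 4 * b.
Proof.
move=> le_v w0 le_w; have := mnorm_toC le_v.
rewrite /stack (mnorm_col_mx (toC v) (w%:M : 'M[R[i]]_1)).
have : mnorm (w%:M : 'M[R[i]]_1) <= b *+ (1 * 1).
  apply: mnorm_le => i j; rewrite !ord1 mxE eqxx mulr1n.
  by apply: le_trans (cmod_le_ReIm _) _; rewrite w0 normr0 add0r.
by rewrite muln1 mulr1n -mulr_natl; lra.
Qed.

(** One constant and one threshold for the four estimates. *)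
Lemma coefficients_bound x0 : exists h0 c : R, [/\ 0 < h0, 0 <= c
  & forall h, 0 < h < h0 ->
    [/\ cmod (K1 A U h x0) <= c * h, cmod (K2 A U h x0) <= c * h,
        cmod (K3 A U h x0 - 1) <= c * h ^+ 2
      & cmod (K4 A U h x0) <= c * h ^+ 2]].
Proof.
have [c1 n1] := Oh_K1 A U x0; have [c2 n2] := Oh_K2 A U x0.
have [c3 n3] := Oh_K3 A U x0; have [c4 n4] := Oh_K4 A U x0.
have : \forall h \near 0^'+,
 [/\ cmod (K1 A U h x0) <= c1 * h, cmod (K2 A U h x0) <= c2 * h,
  cmod (K3 A U h x0 - 1) <= c3 * h ^+ 2 & cmod (K4 A U h x0) <= c4 * h ^+ 2].
  by near=> h; split; near: h.
case=> h0 /= h0_gt0 bh0; exists h0, (`|c1| + `|c2| + `|c3| + `|c4|); split => //.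
move=> h /andP[h_gt0 lt_h].
have [] := bh0 h; rewrite /= ?sub0r ?normrN ?(gtr0_norm h_gt0) //.
have le (c : R) k : c <= `|c1| + `|c2| + `|c3| + `|c4| ->
    c * h ^+ k <= (`|c1| + `|c2| + `|c3| + `|c4|) * h ^+ k.
  by move=> lec; rewrite ler_wpM2r // exprn_ge0 // ltW.
have := normr_ge0 c1; have := normr_ge0 c2; have := normr_ge0 c3; have := normr_ge0 c4.
have := ler_norm c1; have := ler_norm c2; have := ler_norm c3; have := ler_norm c4.
move=> e1 e2 e3 e4 z1 z2 z3 z4 a1 a2 a3 a4; split.
- by apply: le_trans a1 _; rewrite ler_wpM2r ?(ltW h_gt0) //; lra.
- by apply: le_trans a2 _; rewrite ler_wpM2r ?(ltW h_gt0) //; lra.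
- by apply: le_trans a3 _; apply: le; lra.
- by apply: le_trans a4 _; apply: le; lra.
Unshelve. all: by end_near. Qed.

(** For small steps this is [scheme_mass_shell], with [h ^ 2] collected from
    both error terms; the remaining steps are covered by the boundedness of the
    mass shell on [K]. *)
Lemma near_mass_shell (x0 v0 : 'cV[R]_3) (t0 w0 : R[i])
    (K : set ('cV[R]_3 * 'cV[R]_3 * R)) :
  compact K -> smooth_field A -> smooth U ->
  exists C : R, forall (h : R) (x : nat -> 'cV[R]_3) (t : nat -> R[i])
      (v : nat -> 'cV[R]_3) (w : nat -> R[i]),
    0 < h ->
    [\/ method2 A U x0 t0 v0 w0 h x t v w,
        method3 A U x0 t0 v0 w0 h x t v w
      | method4 A U x0 t0 v0 w0 h x t v w] ->
    forall n : nat, stays_in x v w K n ->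
      cmod (mass_shell (v n) (w n) - mass_shell (v 0%N) (w 0%N)) <= C * h ^+ 2.
Proof.
move=> cK sA sU; have [b [b_ge0 le_b]] := state_bound cK sA sU.
have [h0 [c [h0_gt0 c_ge0 le_c]]] := coefficients_bound x0.
(* [q h ^ 2] bounds the matrices [P] and [g] the matrices [G] of all methods. *)
pose m := 4 * b; pose q := c * (4 + (24 * b) ^+ 2); pose g := 96 * c * b + 24 * b.
have q_ge0 : 0 <= q by rewrite mulr_ge0 // addr_ge0 // sqr_ge0.
have cb_ge0 : 0 <= c * b by exact: mulr_ge0.
(* Below [h1] the estimates on the coefficients hold, and [q h ^ 2 <= 1 / 2]. *)
pose h1 := Num.min h0 (2 * q + 2)^-1.
have q2_gt0 : 0 < 2 * q + 2 by lra.
have h1_gt0 : 0 < h1 by rewrite lt_min h0_gt0 invr_gt0.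
exists (m ^+ 2 * (10 * q + g ^+ 2) + m ^+ 2 / h1 ^+ 2) => h x t v w h_gt0 meth n inK.
have st : starting A U x0 t0 v0 w0 h x t v w by case: meth => -[].
have x0E : x 0%N = x0 by case: st => -[].
have [_ _ im] := st.
have le_state k : (k <= n)%N -> mnorm (stack (v k) (w k)) <= m.
  move=> /inK/le_b[_ _ le_v le_w]; apply: mnorm_stack => //.
  by have [] := im k.
have m2_ge0 : 0 <= m ^+ 2 / h1 ^+ 2 by rewrite divr_ge0 // sqr_ge0.
have m_ge0 : 0 <= m by rewrite mulr_ge0.
have mg_ge0 : 0 <= m ^+ 2 * (10 * q + g ^+ 2).
  by rewrite mulr_ge0 ?addr_ge0 ?sqr_ge0 // mulr_ge0.
rewrite mulrDl; case: (ltP h h1) => [lt_h|le_h]; last first.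
  (* A step bounded away from 0 leaves room for any bounded variation. *)
  have le_q k : (k <= n)%N -> cmod (mass_shell (v k) (w k)) <= m ^+ 2 / 2.
    move=> /le_state le_k; rewrite mass_shellE cmodM cmodV cmod_nat.
    rewrite mulrC ler_wpM2r //; apply: le_trans (cmod_cform _ _) _.
    by rewrite expr2; apply: ler_pM; rewrite ?mnorm_ge0.
  apply: le_trans (cmodB_le _ _) _.
  apply: (@le_trans _ _ (m ^+ 2)).
    by have := le_q n (leqnn _); have := le_q 0%N (leq0n _); lra.
  have : m ^+ 2 <= m ^+ 2 / h1 ^+ 2 * h ^+ 2.
    rewrite -mulrA ler_peMr ?sqr_ge0 // mulrC ler_pdivlMr ?exprn_gt0 // mul1r.
    by rewrite lerXn2r ?nnegrE ?(ltW h1_gt0) ?(ltW h_gt0).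
  have := mulr_ge0 mg_ge0 (sqr_ge0 h); lra.
case: n => [|n] in inK le_state *.
  by rewrite subrr cmod0 addr_ge0 // mulr_ge0 ?sqr_ge0 //.
have [le_hh0 le_hq] : h < h0 /\ h < (2 * q + 2)^-1.
  by apply/andP; rewrite -lt_min.
have [c1 c2 c3 c4] := le_c h (introT andP (conj h_gt0 le_hh0)).
have [le_B le_E _ _] := le_b _ _ _ (inK n.+1 (leqnn _)).
have [] := le_b _ _ _ (inK 0%N (leq0n _)); rewrite x0E => le_B0 _ _ _.
have p_le : q * h ^+ 2 <= 1 / 2.
  have : h * (2 * q + 2) < 1 by rewrite -ltr_pdivlMr ?div1r.
  have : 0 <= q * h by rewrite mulr_ge0 // ltW.
  rewrite expr2; nra.
have [G [P [sch le_G le_P]]] : exists G P : nat -> 'M[R[i]]_4,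
    [/\ skew_scheme h (fun j => stack (x j) (t j))
          (fun j => stack (v j) (w j)) G P,
      mnorm (G n.+1) <= g & mnorm (P n.+1) <= q * h ^+ 2].
  have mF := mnorm_Fmx le_B le_E.
  case: meth => [M2|M3|M4].
  - exists (fun k => force_mx2 A U x0 h (x k)), (fun k => momentum_mx2 A U x0 h (x k)).
    split.
    + exact: method2_scheme M2.
    + by have := mnorm_force_mx2 le_B le_E h_gt0 le_B0 c1 c2; rewrite /g; lra.
    + exact: mnorm_momentum_mx2.
  - exists (fun k => force_mx3 A U x0 h (x k)), (fun k => (K3 A U h x0 - 1)%:M).
    split.
    + exact: method3_scheme M3.
    + have h2_ge0 : 0 <= 2 / h by rewrite divr_ge0 // ltW.
      rewrite mnormZ cmodM cmod_real ger0_norm //.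
      apply: (@le_trans _ _ (2 / h * (c * h) * (24 * b))).
        apply: ler_pM; rewrite ?mnorm_ge0 //; first by rewrite mulr_ge0 ?cmod_ge0.
        by rewrite ler_wpM2l.
      have -> : 2 / h * (c * h) * (24 * b) = 48 * (c * b) by field; rewrite gt_eqF.
      by rewrite /g; lra.
    + rewrite -scalemx1 mnormZ mnorm1 /q.
      have := mulr_ge0 (mulr_ge0 c_ge0 (sqr_ge0 h)) (sqr_ge0 (24 * b)); nra.
  - exists (fun k => Fmx A U (x k)), (fun k => 0); split.
    + exact: method4_scheme M4.
    + by rewrite /g; lra.
    + by rewrite mnorm0 mulr_ge0 ?sqr_ge0.
have := scheme_mass_shell h_gt0 st sch (ltn0Sn n) (le_state n.+1 (leqnn _))
  le_G le_P p_le.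
have := mulr_ge0 m2_ge0 (sqr_ge0 h).
have -> : m ^+ 2 * (10 * (q * h ^+ 2) + h ^+ 2 * g ^+ 2) =
  m ^+ 2 * (10 * q + g ^+ 2) * h ^+ 2 by ring.
lra.
Qed.

End NearConservation.

Theorem theorem3 (R : realType)
    (A : 'cV[R]_3 -> 'cV[R]_3) (U : 'cV[R]_3 -> R)
    (hA : smooth_field A) (hU : smooth U)
    (x0 : 'cV[R]_3) (t0 : R[i]) (v0 : 'cV[R]_3) (w0 : R[i])
    (ht0 : imaginary t0) (hw0 : imaginary w0)
    (K : set ('cV[R]_3 * 'cV[R]_3 * R)) (hK : compact K) :
  (forall (h : R) (x : nat -> 'cV[R]_3) (t : nat -> R[i])
          (v : nat -> 'cV[R]_3) (w : nat -> R[i]),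
      0 < h -> method1 A U x0 t0 v0 w0 h x t v w ->
      forall n : nat, stays_in x v w K n.+1 ->
        mass_shell (v n.+1) (w n.+1) = mass_shell (v n) (w n))
  /\
  (forall N : nat, (3 <= N)%N ->
    exists C : R,
    forall (h : R) (x : nat -> 'cV[R]_3) (t : nat -> R[i])
           (v : nat -> 'cV[R]_3) (w : nat -> R[i]),
      0 < h ->
      [\/ method2 A U x0 t0 v0 w0 h x t v w,
          method3 A U x0 t0 v0 w0 h x t v w
        | method4 A U x0 t0 v0 w0 h x t v w] ->
      forall n : nat, n%:R * h <= h ^ (- (N%:Z) + 2) -> stays_in x v w K n ->
        `|mass_shell (v n) (w n) - mass_shell (v 0%N) (w 0%N)| <= (C * h ^+ 2)%:C).
Proof.
split=> [h x t v w _ M1 n _|N _]; first exact: method1_mass_shell M1 n.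
have [C le_C] := near_mass_shell x0 v0 t0 w0 hK hA hU.
exists C => h x t v w h_gt0 meth n _ inK.
by rewrite normr_cmod lecR; exact: (le_C h x t v w h_gt0 meth n inK).
Qed.
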